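(* Let $A$ be an irreducible affine Cartan matrix not of type $A_{2n}^{(2)}$, with double affine Weyl group $\tilde W$, and let $R^\iota$ be the root system associated with $R$ by the involution $\iota$, with double affine Weyl group $\tilde W^\iota$ (see context; objects attached to $R^\iota$ carry the superscript $\iota$). Then $M^\iota=\sqrt p\,\mathring Q$ and $\mathring Q^\iota=\frac1{\sqrt p}M$. Furthermore, the map $\phi_{\tilde W}:\tilde W\to\tilde W^\iota$ defined by $$\phi_{\tilde W}(\mathring w)=\mathring w\ (\mathring w\in\mathring W),\quad \phi_{\tilde W}(\lambda_\mu)=\tau^\iota_{\frac1{\sqrt p}\mu}\ (\mu\in M),\quad \phi_{\tilde W}(\tau_\beta)=\lambda^\iota_{\sqrt p\,\beta}\ (\beta\in\mathring Q),\quad \phi_{\tilde W}(\tau_\delta)=\tau^\iota_{-\delta}$$ is an isomorphism of groups, and the inverse of $\phi_{\tilde W}$ is $\phi_{\tilde W^\iota}$ (the map defined in the same way starting from $R^\iota$).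
   Context: Root data. $A=(a_{jk})_{0\le j,k\le n}$ is an irreducible affine Cartan matrix (enumeration of vertices as in Kac's Table Aff), not of type $A_{2n}^{(2)}$. $a_j$ are the numerical labels of the Dynkin diagram of $A$, $a_j^\vee$ those of $A^t$ (so $a_0=1$), $d_j=a_j/a_j^\vee$. $R$ is the affine root system with basis $\alpha_0,\dots,\alpha_n$, $\mathring R$ the finite root system with basis $\alpha_1,\dots,\alpha_n$, $\mathring{\mathfrak h}^*$ the real span of $\alpha_1,\dots,\alpha_n$, $\delta=\sum_j a_j\alpha_j$, and $\mathfrak h^*=\mathring{\mathfrak h}^*\oplus\mathbb R\delta\oplus\mathbb R\Lambda_0$ with symmetric bilinear form $(\alpha_j,\alpha_k)=d_j^{-1}a_{jk}$, $(\Lambda_0,\alpha_j)=\delta_{j,0}$ (Kronecker), $(\Lambda_0,\Lambda_0)=0$. $\alpha^\vee=2\alpha/(\alpha,\alpha)$ (so $\alpha_j^\vee=d_j\alpha_j$), $\theta=\delta-\alpha_0\in\mathring R$, $\mathring Q=\oplus_{j=1}^n\mathbb Z\alpha_j$, $Q=\mathring Q\oplus\mathbb Z\delta$. $s_\alpha(x)=x-(x,\alpha^\vee)\alpha$, $s_j=s_{\alpha_j}$; the affine Weyl group is $W=\langle s_0,\dots,s_n\rangle\subset GL(\mathfrak h^* )$, the finite one is $\mathring W=\langle s_1,\dots,s_n\rangle$. Set $e_j=\max\{1,d_j\}$ for $1\le j\le n$; this depends only on the length of $\alpha_j$, so write $e_s,e_l$ for short, long simple roots ($e_s=e_l$ if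 all roots have the same length). $p:=e_s\in\{1,2,3\}$. $A_j=e_j\alpha_j$, $M=\oplus_{j=1}^n\mathbb ZA_j$. $W$ is the semidirect product of $\mathring W$ and the lattice $\{\lambda_\mu:\mu\in M\}$, $w\lambda_\mu w^{-1}=\lambda_{w(\mu)}$, where $\lambda_\mu(x)=x-(x,\mu)\delta$ for $x\in\mathring{\mathfrak h}^*\oplus\mathbb R\delta$ and $\lambda_\mu(x+\Lambda_0)\equiv x+\mu+\Lambda_0 \bmod \mathbb R\delta$ for $x\in\mathring{\mathfrak h}^*$ (so $\lambda_{-\theta}=s_\theta s_0$). The double affine Weyl group $\tilde W$ is the semidirect product $W\ltimes Q$, where $Q$ is written as the abelian group of elements $\tau_\beta$ ($\beta\in Q$), with $w\tau_\beta w^{-1}=\tau_{w(\beta)}$ for $w\in W$. The involution $\iota$. $R^\iota$ is the affine root system realized in $\mathfrak h^*$, with the same scalar product, $\delta^\iota=\delta$, $\Lambda_0^\iota=\Lambda_0$, whose finite part $\mathring R^\iota$ has basis $\alpha_j^\iota=A_j/\sqrt p$ ($1\le j\le n$) and which has the same affine type (untwisted/twisted) as $R$: if $p=1$ then $R^\iota=R$, $\alpha_0^\iota=\alpha_0$; if $p\ne1$ (types $B_n^{(1)},C_n^{(1)},F_4^{(1)},G_2^{(1)}$) then $R^\iota$ is the untwisted affine root system of $\mathring R^\iota$, $\alpha_0^\iota=\delta-\theta^\iota$ with $\theta^\iota$ the highest root of $\mathring R^\iota$. The finite Weyl groups of $\mathring R$ and $\mathring R^\iota$ coincide and are identified. 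*)

(* Defs.v *)
From HB Require Import structures.
From mathcomp Require Import all_boot all_order all_algebra.
From mathcomp Require Import boolp classical_sets functions reals.

Set Implicit Arguments.
Unset Strict Implicit.
Unset Printing Implicit Defensive.

Import Order.TTheory GRing.Theory Num.Theory.
Local Open Scope classical_set_scope.
Local Open Scope ring_scope.

(** * Affine Cartan matrices (V. Kac, Infinite dimensional Lie algebras, ch. 4) *)

Definition generalized_cartan (m : nat) (A : 'M[int]_m) : Prop :=
  [/\ forall j, A j j = 2,
      forall j k, j != k -> A j k <= 0 &
      forall j k, A j k = 0 -> A k j = 0].

Definition indecomposable (m : nat) (A : 'M[int]_m) : Prop :=
  forall S : {set 'I_m}, S != finset.set0 -> S != [set: 'I_m]%SET ->
    exists j k, [/\ j \in S, k \notin S & A j k != 0].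

(* Class (Aff) of Kac, Theorem 4.3: corank one, a positive null vector, and
   A v >= 0 only if A v = 0. *)
Definition affine_cartan (R : realType) (n : nat) (A : 'M[int]_n.+1) : Prop :=
  let AR : 'M[R]_n.+1 := map_mx intr A in
  [/\ generalized_cartan A,
      indecomposable A,
      \rank AR = n,
      exists u : 'cV[R]_n.+1, (forall j, 0 < u j 0) /\ AR *m u = 0 &
      forall v : 'cV[R]_n.+1, (forall j, 0 <= (AR *m v) j 0) -> AR *m v = 0].

(* The diagrams of Kac, Tables Aff 1, Aff 2 and Aff 3.  [AffA n] is A_n^(1), and
   similarly for B, C, D; [AffA2even l] is A_{2l}^(2), [AffA2odd l] is
   A_{2l-1}^(2), [AffD2 l] is D_{l+1}^(2). *)
Inductive affine_type : Type :=
| AffA (n : nat) | AffB (n : nat) | AffC (n : nat) | AffD (n : nat)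
| AffE6 | AffE7 | AffE8 | AffF4 | AffG2
| AffA2even (l : nat) | AffA2odd (l : nat) | AffD2 (l : nat)
| AffE6tw2 | AffD4tw3.

Definition affine_type_valid (X : affine_type) : bool :=
  match X with
  | AffA n => (1 <= n)%N
  | AffB n => (3 <= n)%N
  | AffC n => (2 <= n)%N
  | AffD n => (4 <= n)%N
  | AffA2even l => (1 <= l)%N
  | AffA2odd l => (3 <= l)%N
  | AffD2 l => (2 <= l)%N
  | _ => true
  end.

(* The vertices are 0, ..., affine_rank X. *)
Definition affine_rank (X : affine_type) : nat :=
  match X with
  | AffA n | AffB n | AffC n | AffD n => n
  | AffE6 => 6
  | AffE7 => 7
  | AffE8 => 8
  | AffF4 => 4
  | AffG2 => 2
  | AffA2even l | AffA2odd l | AffD2 l => l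
  | AffE6tw2 => 4
  | AffD4tw3 => 2
  end%N.

(* An edge (j, k, x, y) stands for a_jk = - x and a_kj = - y; thus if x > y the
   arrow of the diagram points towards j. *)
Definition dynkin_edge : Type := (nat * nat * nat * nat)%type.

Definition simple_edge (j k : nat) : dynkin_edge := (j, k, 1%N, 1%N).

(* j -- j+1 -- ... -- k *)
Definition simple_chain (j k : nat) : seq dynkin_edge :=
  [seq simple_edge i i.+1 | i <- iota j (k - j)].

Definition dynkin_edges (X : affine_type) : seq dynkin_edge :=
  match X with
  | AffA n => if n == 1 then [:: (0, 1, 2, 2)]
              else simple_edge 0 n :: simple_chain 0 n
  | AffB n => simple_edge 0 2 :: simple_chain 1 n.-1 ++ [:: (n.-1, n, 1, 2)]
  | AffC n => (0, 1, 1, 2) :: simple_chain 1 n.-1 ++ [:: (n.-1, n, 2, 1)]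
  | AffD n => simple_edge 0 2 :: simple_chain 1 n.-1
                ++ [:: simple_edge n.-2 n]
  | AffE6 => simple_chain 1 5 ++ [:: simple_edge 3 6; simple_edge 0 6]
  | AffE7 => simple_chain 0 6 ++ [:: simple_edge 3 7]
  | AffE8 => simple_chain 0 7 ++ [:: simple_edge 5 8]
  | AffF4 => simple_chain 0 2 ++ [:: (2, 3, 1, 2); simple_edge 3 4]
  | AffG2 => [:: simple_edge 0 1; (1, 2, 1, 3)]
  | AffA2even l => if l == 1 then [:: (0, 1, 4, 1)]
                   else (0, 1, 2, 1) :: simple_chain 1 l.-1
                          ++ [:: (l.-1, l, 2, 1)]
  | AffA2odd l => simple_edge 0 2 :: simple_chain 1 l.-1
                    ++ [:: (l.-1, l, 2, 1)]
  | AffD2 l => (0, 1, 2, 1) :: simple_chain 1 l.-1 ++ [:: (l.-1, l, 1, 2)]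
  | AffE6tw2 => simple_chain 0 2 ++ [:: (2, 3, 2, 1); simple_edge 3 4]
  | AffD4tw3 => [:: simple_edge 0 1; (1, 2, 3, 1)]
  end%N.

Definition edge_weight (j k : nat) (e : dynkin_edge) : nat :=
  let: (j', k', x, y) := e in
  if (j == j') && (k == k') then x
  else if (j == k') && (k == j') then y else 0%N.

Definition affine_entry (X : affine_type) (j k : nat) : int :=
  if j == k then 2
  else - Posz (\sum_(e <- dynkin_edges X) edge_weight j k e)%N.

(* [A] is of type X, with its vertices enumerated as in Kac's tables. *)
Definition has_affine_type (n : nat) (A : 'M[int]_n.+1) (X : affine_type) :
    Prop :=
  [/\ affine_type_valid X, affine_rank X = n &
      forall j k : 'I_n.+1, A j k = affine_entry X j k].

(** * Numerical labels *)

(* Relatively prime positive integers a_k with sum_k c_jk a_k = 0. *)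
Definition is_labels (R : realType) (m : nat) (C : 'M[R]_m)
    (a : 'I_m -> nat) : Prop :=
  [/\ forall k, (0 < a k)%N,
      \big[gcdn/0%N]_(k < m) a k = 1%N &
      forall j, \sum_(k < m) C j k * (a k)%:R = 0].

(* [xget x0 P] is an element of P if there is one, x0 otherwise. *)
Definition labels (R : realType) (m : nat) (C : 'M[R]_m) : 'I_m -> nat :=
  xget (fun=> 1%N) [set a | is_labels C a].

Definition label_ratio (R : realType) (m : nat) (C : 'M[R]_m) (j : 'I_m) : R :=
  (labels C j)%:R / (labels C^T j)%:R.

(** * Generated subgroups and integral spans *)

Definition subgroup_closed (T : Type) (H : set (T -> T)) : Prop :=
  [/\ H id,
      forall f g, H f -> H g -> H (f \o g) &
      forall f g, H f -> cancel f g -> cancel g f -> H g].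

Definition generated (T : Type) (S : set (T -> T)) : set (T -> T) :=
  smallest (@subgroup_closed T) S.

Definition int_span (V : zmodType) (m : nat) (v : 'I_m -> V) : set V :=
  [set x | exists c : 'I_m -> int, x = \sum_(j < m) v j *~ c j].

(** * The space h^* *)

(* Coordinates with respect to alpha_0, ..., alpha_n, Lambda_0; since a_0 = 1 the
   vectors alpha_1, ..., alpha_n, delta, Lambda_0 form a basis as well. *)
Notation hstar R n := 'rV[R]_(n.+1 + 1).

Section Realization.
Variables (R : realType) (n : nat) (A : 'M[int]_n.+1).

Definition Lambda0 : hstar R n := delta_mx 0 (rshift n.+1 ord0).

Definition alpha (j : 'I_n.+1) : hstar R n := delta_mx 0 (lshift 1 j).

Definition delta : hstar R n :=
  \sum_(j < n.+1) alpha j *+ labels (map_mx (intr : int -> R) A) j.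

(* (alpha_j, alpha_k) = d_j^-1 a_jk, (Lambda_0, alpha_j) = delta_{j,0} and
   (Lambda_0, Lambda_0) = 0. *)
Definition gram : 'M[R]_(n.+1 + 1) :=
  let AR : 'M[R]_n.+1 := map_mx intr A in
  block_mx (\matrix_(j, k) ((label_ratio AR j)^-1 * AR j k))
           (\col_j (j == ord0)%:R)
           (\row_j (j == ord0)%:R)
           0.

Definition form (x y : hstar R n) : R := (x *m gram *m y^T) 0 0.

Definition coroot (a : hstar R n) : hstar R n := (2 / form a a) *: a.

Definition reflection (a x : hstar R n) : hstar R n :=
  x - form x (coroot a) *: a.

(* The coefficient of delta in the image of Lambda_0, left open by
   lambda_mu (x + Lambda_0) = x + mu + Lambda_0 mod R delta, is forced by the
   invariance of the form, whence -(mu, mu) / 2. *)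
Definition lambda (mu x : hstar R n) : hstar R n :=
  x + form x delta *: mu
    - (form x mu + form mu mu / 2 * form x delta) *: delta.

(** * The finite root system with basis [b] *)

Section FiniteRootSystem.
Variable b : 'I_n -> hstar R n.

Definition fin_Weyl : set (hstar R n -> hstar R n) :=
  generated [set reflection (b i) | i in [set: 'I_n]].

Definition fin_roots : set (hstar R n) :=
  [set x | exists w i, fin_Weyl w /\ x = w (b i)].

Definition is_highest_root (th : hstar R n) : Prop :=
  fin_roots th /\
  forall x, fin_roots x ->
    exists c : 'I_n -> nat, th - x = \sum_(i < n) b i *+ c i.

Definition highest_root : hstar R n := xget 0 [set th | is_highest_root th].

End FiniteRootSystem.

(** * The affine root system with basis [al 0], ..., [al n] *)

Section AffineRootSystem.
Variable al : 'I_n.+1 -> hstar R n.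

(* For al = alpha this is A itself. *)
Definition cartan : 'M[R]_n.+1 := \matrix_(j, k) form (coroot (al j)) (al k).

Definition Weyl : set (hstar R n -> hstar R n) :=
  generated [set reflection (al j) | j in [set: 'I_n.+1]].

(* The index i : 'I_n stands for j = i + 1 in 1, ..., n. *)
Definition fin_simple (i : 'I_n) : hstar R n := al (lift ord0 i).

(* d_j and e_j, where d_j is the ratio of the labels of the Cartan matrix of [al]
   and of its transpose *)
Definition dcoef (i : 'I_n) : R := label_ratio cartan (lift ord0 i).
Definition ecoef (i : 'I_n) : R := Num.max 1 (dcoef i).

Definition is_short (i : 'I_n) : Prop :=
  forall k, form (fin_simple i) (fin_simple i)
            <= form (fin_simple k) (fin_simple k).

(* p = e_s, the common value of e_j over the short simple roots *)
Definition pnum : R := xget 1 [set x | exists2 i, is_short i & x = ecoef i].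

(* A_j *)
Definition Avec (i : 'I_n) : hstar R n := ecoef i *: fin_simple i.

Definition Mlattice : set (hstar R n) := int_span Avec.

Definition fin_Qlattice : set (hstar R n) := int_span fin_simple.

Definition Qlattice : set (hstar R n) :=
  [set x | exists2 y, fin_Qlattice y & exists c : int, x = y + delta *~ c].

(* W x| Q: the pair (b, w) is the element tau_b w. *)
Definition dWeyl : set (hstar R n * (hstar R n -> hstar R n)) :=
  [set g | Qlattice g.1 /\ Weyl g.2].

(* The simple roots of R^iota *)
Definition iota_fin (i : 'I_n) : hstar R n := (Num.sqrt pnum)^-1 *: Avec i.

Definition iota_root (j : 'I_n.+1) : hstar R n :=
  if unlift ord0 j is Some i then iota_fin i
  else if pnum == 1 then al ord0
  else delta - highest_root iota_fin.

End AffineRootSystem.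

Definition dmul (g h : hstar R n * (hstar R n -> hstar R n)) :
    hstar R n * (hstar R n -> hstar R n) :=
  (g.1 + g.2 h.1, g.2 \o h.2).

Definition tau (b : hstar R n) : hstar R n * (hstar R n -> hstar R n) :=
  (b, id).

Definition ofWeyl (w : hstar R n -> hstar R n) :
    hstar R n * (hstar R n -> hstar R n) := (0, w).

(* [f] restricts to a group homomorphism from the double affine Weyl group of al
   to that of iota_root al which has the values prescribed for phi. *)
Definition is_phi (al : 'I_n.+1 -> hstar R n)
    (f : hstar R n * (hstar R n -> hstar R n) ->
         hstar R n * (hstar R n -> hstar R n)) : Prop :=
  [/\ set_fun (dWeyl al) (dWeyl (iota_root al)) f,
      forall g h, dWeyl al g -> dWeyl al h -> f (dmul g h) = dmul (f g) (f h) &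
      [/\ forall w, fin_Weyl (fin_simple al) w -> f (ofWeyl w) = ofWeyl w,
          forall mu, Mlattice al mu ->
            f (ofWeyl (lambda mu)) = tau ((Num.sqrt (pnum al))^-1 *: mu),
          forall b, fin_Qlattice al b ->
            f (tau b) = ofWeyl (lambda (Num.sqrt (pnum al) *: b)) &
          f (tau delta) = tau (- delta)]].

End Realization.

(* Main.v *)
Require Import Defs.
From HB Require Import structures.
From mathcomp Require Import all_boot all_order all_algebra.
From mathcomp Require Import boolp classical_sets functions reals.
From mathcomp Require Import lra ring zify.
Set Implicit Arguments.
Unset Strict Implicit.
Unset Printing Implicit Defensive.
Import Order.TTheory GRing.Theory Num.Theory.
Local Open Scope classical_set_scope.
Local Open Scope ring_scope.

(* The lattice M is even and positive definite, its basis (A_j) is obtuse, and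
   theta = delta - alpha_0 is a vector of norm 2 in M which is dominant and has
   full support.  From this alone one gets, without looking at the type: theta is
   conjugate to a simple root (descent on the height, since a vector of norm 2
   cannot have coefficients of both signs); the conjugates of theta span M; and
   every root is bounded by theta.  As s_theta s_0 = lambda_{- theta}, the affine
   Weyl group is the group of the lambda_mu w with mu in M, and mu is read off the
   image of Lambda_0.  Hence phi sends tau_{b + c delta} lambda_mu w to the element
   with lattice part mu / sqrt p - (c + (mu, b)) delta and affine part
   lambda_{sqrt p b} w, a formula which is an involution.  If p <> 1, the same
   applies to R^iota with sqrt p times the highest short root in the role of theta.
   Only the labels and the highest short root are taken from the tables. *)

(** * The invariant form *)

(** The work is done in M because roots may have norm 2/p, so that the root lattice need not be even
    or integral, whereas (A_i, A_j) is the integer e_i f_i times an entry of a Cartan matrix (d_i =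
    e_i / f_i). Norm 2 is then the least nonzero norm, and the sign and bound arguments rest on
    this. Theta must be conjugate to a simple root for s_theta to lie in the finite Weyl group; its
    full support makes its orbit reach every A_i. The sign in phi(tau_delta) comes from lambda_mu
    tau_b = tau_{b - (mu, b) delta} lambda_mu: exchanging the two lattices reverses commutators. One
    formula with one p serves both directions because e_j e_j^iota = p. A homomorphism with
    prescribed values is determined only on the double affine Weyl group, while phi is a function on
    all pairs. Hence existence is shown by one explicit total function, and all else by comparison
    with it on the group. *)

Section Form.
Variables (R : realType) (n : nat) (A : 'M[int]_n.+1).
Local Notation V := (hstar R n).
Local Notation form := (@Defs.form R n A).
Implicit Types x y z : V.

Lemma formDl x y z : form (x + y) z = form x z + form y z.
Proof. by rewrite /Defs.form !mulmxDl mxE. Qed.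

Lemma formDr x y z : form z (x + y) = form z x + form z y.
Proof. by rewrite /Defs.form linearD mulmxDr mxE. Qed.

Lemma formZl a x z : form (a *: x) z = a * form x z.
Proof. by rewrite /Defs.form -!scalemxAl mxE. Qed.

Lemma formZr a x z : form z (a *: x) = a * form z x.
Proof. by rewrite /Defs.form linearZ -scalemxAr mxE. Qed.

Lemma formNl x z : form (- x) z = - form x z.
Proof. by rewrite -scaleN1r formZl mulN1r. Qed.

Lemma formNr x z : form z (- x) = - form z x.
Proof. by rewrite -scaleN1r formZr mulN1r. Qed.

Lemma form0l z : form 0 z = 0.
Proof. by rewrite -(scale0r 0) formZl mul0r. Qed.

Lemma form0r z : form z 0 = 0.
Proof. by rewrite -(scale0r 0) formZr mul0r. Qed.

Lemma form_suml I (r : seq I) (P : pred I) (F : I -> V) z :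
  form (\sum_(i <- r | P i) F i) z = \sum_(i <- r | P i) form (F i) z.
Proof. by apply: (big_morph (form^~ z)) => [x y|]; rewrite ?formDl ?form0l. Qed.

Lemma form_sumr I (r : seq I) (P : pred I) (F : I -> V) z :
  form z (\sum_(i <- r | P i) F i) = \sum_(i <- r | P i) form z (F i).
Proof. by apply: (big_morph (form z)) => [x y|]; rewrite ?formDr ?form0r. Qed.

Definition formE := (formDl, formDr, formNl, formNr, formZl, formZr).

Lemma form_delta_mx j k :
  form (delta_mx 0 j) (delta_mx 0 k) = gram R A j k.
Proof. by rewrite /Defs.form trmx_delta -rowE -colE !mxE. Qed.

Lemma form_alpha j k : form (alpha R j) (alpha R k) =
  (label_ratio (map_mx (intr : int -> R) A) j)^-1 * (A j k)%:~R.
Proof. by rewrite form_delta_mx block_mxEul !mxE. Qed.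

Lemma form_Lambda_alpha j : form (Lambda0 R n) (alpha R j) = (j == ord0)%:R.
Proof. by rewrite form_delta_mx block_mxEdl mxE. Qed.

(* The span of alpha_1, ..., alpha_n. *)
Definition fin x : Prop :=
  x 0 (lshift 1 ord0) = 0 /\ x 0 (rshift n.+1 ord0) = 0.

Lemma fin0 : fin 0. Proof. by split; rewrite mxE. Qed.

Lemma finD x y : fin x -> fin y -> fin (x + y).
Proof. by move=> [x1 x2] [y1 y2]; split; rewrite mxE ?x1 ?x2 ?y1 ?y2 addr0. Qed.

Lemma finZ a x : fin x -> fin (a *: x).
Proof. by move=> [x1 x2]; split; rewrite mxE ?x1 ?x2 mulr0. Qed.

Lemma finN x : fin x -> fin (- x).
Proof. by rewrite -scaleN1r; apply: finZ. Qed.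

Lemma finB x y : fin x -> fin y -> fin (x - y).
Proof. by move=> fx fy; apply: finD => //; apply: finN. Qed.

Lemma fin_sum I (r : seq I) (P : pred I) (F : I -> V) :
  (forall i, P i -> fin (F i)) -> fin (\sum_(i <- r | P i) F i).
Proof. by move=> FF; apply: (big_ind fin) => //; [exact: fin0|exact: finD]. Qed.

Lemma fin_alpha i : fin (alpha R (lift ord0 i)).
Proof. by split; rewrite mxE eqxx /= ?eq_lshift ?eq_rlshift. Qed.

Lemma fin_expand x : fin x ->
  x = \sum_(i < n) x 0 (lshift 1 (lift ord0 i)) *: alpha R (lift ord0 i).
Proof.
move=> [x0 xL]; rewrite [LHS]row_sum_delta big_split_ord /= big_ord1 xL.
by rewrite scale0r addr0 big_ord_recl x0 scale0r add0r.
Qed.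

Lemma alpha_free (u : 'I_n -> R) :
  \sum_(i < n) u i *: alpha R (lift ord0 i) = 0 -> forall i, u i = 0.
Proof.
move=> u0 i; have := congr1 (fun v : V => v 0 (lshift 1 (lift ord0 i))) u0.
rewrite summxE mxE (bigD1 i) //= big1 ?addr0 => [|j ji]; last first.
  by rewrite !mxE eqxx eq_lshift (inj_eq lift_inj) eq_sym (negPf ji) mulr0.
by rewrite !mxE !eqxx mulr1.
Qed.

Lemma fin_Lambda x : fin x -> form (Lambda0 R n) x = 0.
Proof.
move=> /fin_expand ->; rewrite form_sumr big1 // => i _.
by rewrite formZr form_Lambda_alpha mulr0.
Qed.

End Form.

(** The type-independent facts about the form. [fin_anisotropic] is positive definiteness, phrased
    so that an equality case in an estimate at once gives a vector equation. *)
Record affine_form (R : realType) (n : nat) (A : 'M[int]_n.+1) : Prop :=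
  AffineForm {
  formC : forall x y : hstar R n, Defs.form A x y = Defs.form A y x;
  form_alpha_delta : forall j, Defs.form A (alpha R j) (delta R A) = 0;
  label0 : labels (map_mx (intr : int -> R) A) ord0 = 1%N;
  fin_anisotropic : forall x : hstar R n,
    fin x -> Defs.form A x x <= 0 -> x = 0 }.

Section AffineForm.
Variables (R : realType) (n : nat) (A : 'M[int]_n.+1).
Hypothesis AF : affine_form R A.
Local Notation V := (hstar R n).
Local Notation form := (@Defs.form R n A).
Local Notation delta := (delta R A).
Local Notation Lambda0 := (Lambda0 R n).
Implicit Types x y z : V.

Lemma delta_alpha0 : delta 0 (lshift 1 ord0) = 1.
Proof.
rewrite /Defs.delta summxE (bigD1 ord0) //= big1 ?addr0 => [|j j0].
  by rewrite mulmxnE (label0 AF) mxE !eqxx.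
by rewrite mulmxnE mxE eqxx eq_lshift eq_sym (negPf j0) mul0rn.
Qed.

Lemma form_delta_delta : form delta delta = 0.
Proof.
rewrite {1}/Defs.delta form_suml big1 // => j _.
by rewrite -scaler_nat formZl (form_alpha_delta AF) mulr0.
Qed.

Lemma form_Lambda_delta : form Lambda0 delta = 1.
Proof.
rewrite /Defs.delta form_sumr (bigD1 ord0) //= big1 ?addr0 => [|j j0].
  by rewrite -scaler_nat formZr (label0 AF) form_Lambda_alpha eqxx mulr1.
by rewrite -scaler_nat formZr form_Lambda_alpha (negPf j0) mulr0.
Qed.

Lemma fin_delta x : fin x -> form x delta = 0.
Proof.
move=> /fin_expand ->; rewrite form_suml big1 // => i _.
by rewrite formZl (form_alpha_delta AF) mulr0.
Qed.

(** A description by orthogonality, hence preserved by every isometry fixing delta and [Lambda0];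
    the coordinates of [fin] do not show this. *)
Lemma finP x : fin x <-> form x delta = 0 /\ form Lambda0 x = 0.
Proof.
split=> [fx|]; first by rewrite fin_delta // fin_Lambda.
have -> : x = \sum_j x 0 (lshift 1 j) *: alpha R j
              + x 0 (rshift n.+1 ord0) *: Lambda0.
  by rewrite [LHS]row_sum_delta big_split_ord /= big_ord1.
set c := x 0 (rshift _ _) => -[xd xL].
have c0 : c = 0.
  rewrite -xd formDl formZl form_Lambda_delta mulr1 form_suml big1 ?add0r //.
  by move=> j _; rewrite formZl (form_alpha_delta AF) mulr0.
move: xL; rewrite c0 scale0r addr0 form_sumr big_ord_recl big1 => [|j _].
  rewrite formZr form_Lambda_alpha eqxx mulr1 addr0 => x0.
  rewrite big_ord_recl x0 scale0r add0r; apply: fin_sum => i _.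
  by apply: finZ; apply: fin_alpha.
by rewrite formZr form_Lambda_alpha mulr0.
Qed.

Lemma fin_ge0 x : fin x -> 0 <= form x x.
Proof.
move=> fx; rewrite leNgt; apply/negP => lt0.
by move: (lt0); rewrite (fin_anisotropic AF fx (ltW lt0)) form0l ltxx.
Qed.

Lemma fin_gt0 x : fin x -> x != 0 -> 0 < form x x.
Proof.
move=> fx; apply: contra_neqT; rewrite -leNgt; exact: fin_anisotropic.
Qed.

End AffineForm.

(** * Reflections and finite Weyl groups *)

Lemma generated_subgroup (T : Type) (S : set (T -> T)) :
  subgroup_closed (generated S).
Proof.
split=> [H [[H1 _ _] _]|f g Sf Sg H HH|f g Sf fg gf H HH] //.
  by case: (HH) => -[_ HM _] _; apply: HM; [exact: Sf|exact: Sg].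
by case: (HH) => -[_ _ HV] _; apply: HV fg gf; exact: Sf.
Qed.

Lemma generated_gen (T : Type) (S : set (T -> T)) f : S f -> generated S f.
Proof. by move=> Sf H [_]; apply. Qed.

Lemma generated_min (T : Type) (S H : set (T -> T)) :
  subgroup_closed H -> S `<=` H -> generated S `<=` H.
Proof. by move=> HH SH f; apply. Qed.

Section Reflection.
Variables (R : realType) (n : nat) (A : 'M[int]_n.+1).
Hypothesis AF : affine_form R A.
Local Notation V := (hstar R n).
Local Notation form := (@Defs.form R n A).
Local Notation delta := (delta R A).
Local Notation Lambda0 := (Lambda0 R n).
Local Notation reflection := (@reflection R n A).
Implicit Types a x y z : V.

Lemma reflectionE a x : reflection a x = x - (2 * form x a / form a a) *: a.
Proof.
by rewrite /Defs.reflection /coroot formZr mulrAC.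
Qed.

Lemma reflectionZ c a : c != 0 -> reflection (c *: a) = reflection a.
Proof.
move=> c0; apply/funext => x; rewrite !reflectionE !formE scalerA !invfM.
congr (_ - _ *: _); rewrite -[RHS]mul1r -(divff c0) -[RHS]mul1r -(divff c0).
by ring.
Qed.

Lemma reflectionK a : involutive (reflection a).
Proof.
move=> x; rewrite !reflectionE !formE.
(* The inverse of 0 is 0, so the reflection in an isotropic vector is the identity. *)
have [->|a0] := eqVneq (form a a) 0.
  by rewrite invr0 !mulr0 scale0r !subr0.
rewrite -addrA -opprD -scalerDl.
suff -> : 2 * form x a / form a a + 2 * (form x a - 2 * form x a / form a a * form a a)
  / form a a = 0 by rewrite scale0r subr0.
by field.
Qed.

Lemma reflection_form a x y : form (reflection a x) (reflection a y) = form x y.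
Proof.
rewrite !reflectionE !formE (formC AF a y).
have [->|a0] := eqVneq (form a a) 0; first by rewrite invr0; ring.
by field.
Qed.

(** Fixing delta and [Lambda0] is what makes such a map preserve [fin] and permute the translations
    by conjugation. *)
Record fin_isometry (w : V -> V) : Prop := FinIsometry {
  isoD : {morph w : x y / x + y};
  isoZ : forall c, {morph w : x / c *: x};
  iso_form : forall x y, form (w x) (w y) = form x y;
  iso_delta : w delta = delta;
  iso_Lambda : w Lambda0 = Lambda0 }.

Lemma iso_fin w x : fin_isometry w -> fin x -> fin (w x).
Proof.
move=> [_ _ wf wd wL] /(finP AF) [xd xL].
by apply/(finP AF); rewrite -{1}wd -{1}wL !wf.
Qed.

Lemma fin_isometry_id : fin_isometry id.
Proof. by []. Qed.

Lemma fin_isometry_comp v w :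
  fin_isometry v -> fin_isometry w -> fin_isometry (v \o w).
Proof.
move=> [vD vZ vf vd vL] [wD wZ wf wd wL]; split=> //=.
- by move=> x y /=; rewrite wD vD.
- by move=> c x /=; rewrite wZ vZ.
- by move=> x y; rewrite vf wf.
- by rewrite wd.
- by rewrite wL.
Qed.

Lemma reflection_fin_isometry a : fin a -> fin_isometry (reflection a).
Proof.
move=> fa; split.
- move=> x y; rewrite !reflectionE formDl mulrDr mulrDl scalerDl opprD.
  by rewrite addrACA.
- move=> c x; rewrite !reflectionE formZl scalerBr scalerA.
  by congr (_ - _ *: _); ring.
- exact: reflection_form.
- rewrite reflectionE (formC AF) (fin_delta AF fa).
  by rewrite mulr0 mul0r scale0r subr0.
- by rewrite reflectionE fin_Lambda // mulr0 mul0r scale0r subr0.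
Qed.

Section FiniteWeyl.
Variable b : 'I_n -> V.
Hypothesis bfin : forall i, fin (b i).
Local Notation W := (fin_Weyl A b).

Lemma fin_Weyl_refl i : W (reflection (b i)).
Proof. by apply: generated_gen; exists i. Qed.

Lemma fin_Weyl_id : W id.
Proof. by case: (generated_subgroup [set reflection (b i) | i in [set: 'I_n]]). Qed.

Lemma fin_Weyl_comp v w : W v -> W w -> W (v \o w).
Proof.
by case: (generated_subgroup [set reflection (b i) | i in [set: 'I_n]]) => _ + _; apply.
Qed.

Lemma fin_Weyl_stable (P : set V) : (forall i x, P x -> P (reflection (b i) x)) ->
  forall w x, W w -> P x -> P (w x).
Proof.
move=> PW w x Ww.
(* An equivalence is carried through the induction because [generated] also closes under
   inverses. *)
suff /(_ w Ww x) -> : W `<=` [set w | forall x, P x <-> P (w x)] by [].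
apply: generated_min => [|_ [i _ <-] y]; last first.
  by split; [exact: PW|move=> /(PW i); rewrite reflectionK].
split=> [y //|f g Pf Pg y|f g Pf fg gf y]; first by rewrite (Pg y) (Pf (g y)).
by rewrite (Pf (g y)) gf.
Qed.

(** [generated] is closed under inverses only once a two-sided inverse function is at hand; its
    existence is proved here by induction. *)
Lemma fin_Weyl_inverse w : W w ->
  exists w', [/\ W w', cancel w w' & cancel w' w].
Proof.
pose H := [set w : V -> V | exists w', [/\ W w', cancel w w' & cancel w' w]].
suff : W `<=` W `&` H by move=> WH /WH [].
apply: generated_min => [|_ [i _ <-]]; last first.
  split; first exact: fin_Weyl_refl.
  exists (reflection (b i)); split; [exact: fin_Weyl_refl|exact: reflectionK..].
split.
- by split; [exact: fin_Weyl_id|exists id; split=> //; exact: fin_Weyl_id].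
- move=> f g [Wf [f' [Wf' ff' f'f]]] [Wg [g' [Wg' gg' g'g]]].
  split; first exact: fin_Weyl_comp.
  exists (g' \o f'); split; [exact: fin_Weyl_comp|exact: can_comp..].
- move=> f g [Wf [f' [Wf' ff' f'f]]] fg gf.
  have -> : g = f' by apply/funext => x; rewrite -[x in LHS]f'f fg.
  by split=> //; exists f.
Qed.

Lemma fin_Weyl_isometry w : W w -> fin_isometry w.
Proof.
suff : W `<=` W `&` fin_isometry by move=> WH /WH [].
apply: generated_min => [|_ [i _ <-]]; last first.
  by split; [exact: fin_Weyl_refl|exact: reflection_fin_isometry].
split.
- by split; [exact: fin_Weyl_id|].
- move=> f g [Wf If] [Wg Ig].
  by split; [exact: fin_Weyl_comp|exact: fin_isometry_comp].
- move=> f g [Wf If] fg gf; split.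
    by case: (generated_subgroup [set reflection (b i) | i in [set: 'I_n]])
      => _ _ /(_ f g Wf fg gf).
  case: If => fD fZ ff fd fL; split.
  + by move=> x y; rewrite -[x in LHS]gf -[y in LHS]gf -fD fg.
  + by move=> c x; rewrite -[x in LHS]gf -fZ fg.
  + by move=> x y; rewrite -ff !gf.
  + by rewrite -[X in g X]fd fg.
  + by rewrite -[X in g X]fL fg.
Qed.

End FiniteWeyl.
End Reflection.

(** * Even lattices with an obtuse basis *)

Definition comb (V : zmodType) (m : nat) (v : 'I_m -> V) (c : 'I_m -> int) : V :=
  \sum_(i < m) v i *~ c i.

Lemma combB (V : zmodType) m (v : 'I_m -> V) c d :
  comb v (fun i => c i - d i) = comb v c - comb v d.
Proof. by rewrite /comb -sumrB; apply: eq_bigr => i _; rewrite mulrzBr. Qed.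

Section Basis.
Variables (R : realType) (n : nat) (A : 'M[int]_n.+1).
Hypothesis AF : affine_form R A.
Local Notation V := (hstar R n).
Local Notation form := (@Defs.form R n A).
Local Notation reflection := (@reflection R n A).
Variable b : 'I_n -> V.
Hypothesis bfin : forall i, fin (b i).
Hypothesis bfree : forall u : 'I_n -> R,
  \sum_i u i *: b i = 0 -> forall i, u i = 0.
Hypothesis obtuse : forall i j, i != j -> form (b i) (b j) <= 0.
Implicit Types (c d u v t : 'I_n -> int) (x y : V).

Lemma comb_fin c : fin (comb b c).
Proof. by apply: fin_sum => i _; rewrite -scaler_int; apply: finZ. Qed.

Lemma comb_eq0 c : comb b c = 0 -> forall i, c i = 0.
Proof.
move=> c0 i; have /eqP : (c i)%:~R = 0 :> R.
  apply: (bfree (u := fun i => (c i)%:~R)); rewrite -[RHS]c0.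
  by apply: eq_bigr => j _; rewrite scaler_int.
by rewrite intr_eq0 => /eqP.
Qed.

Lemma comb_inj c d : comb b c = comb b d -> c =1 d.
Proof.
move=> cd i; apply/eqP; rewrite -subr_eq0; apply/eqP.
by apply: (comb_eq0 (c := fun i => c i - d i)); rewrite combB cd subrr.
Qed.

Lemma form_combl c x : form (comb b c) x = \sum_i (c i)%:~R * form (b i) x.
Proof. by rewrite form_suml; apply: eq_bigr => i _; rewrite -scaler_int formZl. Qed.

Lemma form_combr c x : form x (comb b c) = \sum_i (c i)%:~R * form x (b i).
Proof. by rewrite form_sumr; apply: eq_bigr => i _; rewrite -scaler_int formZr. Qed.

(** Disjoint supports kill the diagonal terms; the others are nonpositive by obtuseness. *)
Lemma obtuse_form u v : (forall i, 0 <= u i) -> (forall i, 0 <= v i) ->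
  (forall i, u i * v i = 0) -> form (comb b u) (comb b v) <= 0.
Proof.
move=> u0 v0 uv; rewrite form_combl; apply: sumr_le0 => i _.
rewrite form_combr mulr_sumr; apply: sumr_le0 => j _; rewrite mulrA.
have [->|ij] := eqVneq i j; first by rewrite -intrM uv mul0r.
by apply: mulr_ge0_le0; [rewrite -intrM ler0z mulr_ge0|exact: obtuse].
Qed.

Definition ppart c i := Num.max (c i) 0.
Definition npart c i := Num.max (- c i) 0.

Lemma ppart_ge0 c i : 0 <= ppart c i. Proof. by rewrite /ppart; lia. Qed.
Lemma npart_ge0 c i : 0 <= npart c i. Proof. by rewrite /npart; lia. Qed.
Lemma part_mul0 c i : ppart c i * npart c i = 0.
Proof.
have [ci|ci] : 0 <= c i \/ c i <= 0 by lia.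
  by rewrite /npart max_r ?mulr0 // oppr_le0.
by rewrite /ppart max_r ?mul0r.
Qed.
Lemma ppartB c : comb b c = comb b (ppart c) - comb b (npart c).
Proof.
rewrite -combB; congr comb.
by apply/funext => i; rewrite /ppart /npart; lia.
Qed.

(* Write comb t - comb c = u - v with u, v nonnegative with disjoint supports.
   If v != 0, then (v, comb c) >= (v, v) >= mu, so that v = comb c is forced by
   positivity, whence u = comb t, whose support meets that of v. *)
Lemma dominant_bound (mu : R) c t :
  (forall v, comb b v != 0 -> mu <= form (comb b v) (comb b v)) ->
  (forall i, 0 < t i) -> (forall i, 0 <= form (comb b t) (b i)) ->
  form (comb b c) (comb b c) <= mu -> forall i, c i <= t i.
Proof.
move=> min t0 dom cmu i; rewrite leNgt; apply/negP => lt_tc.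
pose d i := t i - c i; pose u := ppart d; pose v := npart d.
have v_neq0 : comb b v != 0.
  apply/eqP => /comb_eq0 /(_ i); rewrite /v /npart /d; lia.
have uv : form (comb b v) (comb b u) <= 0.
  rewrite (formC AF); apply: obtuse_form => j; [exact: ppart_ge0|exact: npart_ge0|].
  exact: part_mul0.
have dE : comb b t - comb b c = comb b u - comb b v by rewrite -combB -ppartB.
have vt : 0 <= form (comb b v) (comb b t).
  rewrite form_combl; apply: sumr_ge0 => j _; apply: mulr_ge0.
    by rewrite ler0z npart_ge0.
  by rewrite (formC AF).
have vd : form (comb b v) (comb b t) - form (comb b v) (comb b c) =
    form (comb b v) (comb b u) - form (comb b v) (comb b v).
  by rewrite -!formNr -!formDr dE.
have := min _ v_neq0; move: (comb_inj (c := v) (d := c)) => inj vmu.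
have /subr0_eq /inj vc : comb b v - comb b c = 0.
  apply: (fin_anisotropic AF); first by apply: finB; apply: comb_fin.
  by rewrite !formE (formC AF (comb b c) (comb b v)); lra.
by move: (vc i) (t0 i); rewrite /v /npart /d; lia.
Qed.

End Basis.

(** * Vectors of norm 2 in an even lattice *)

Section EvenLattice.
Variables (R : realType) (n : nat) (A : 'M[int]_n.+1).
Hypothesis AF : affine_form R A.
Local Notation V := (hstar R n).
Local Notation form := (@Defs.form R n A).
Local Notation reflection := (@reflection R n A).
Variables (b : 'I_n -> V) (k : 'I_n -> nat) (c : 'I_n -> 'I_n -> int).
Hypothesis bfin : forall i, fin (b i).
Hypothesis bfree : forall u : 'I_n -> R,
  \sum_i u i *: b i = 0 -> forall i, u i = 0.
Hypothesis k_gt0 : forall i, (0 < k i)%N.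
Hypothesis c_diag : forall i, c i i = 2.
Hypothesis c_le0 : forall i j, i != j -> c i j <= 0.
Hypothesis formb : forall i j, form (b i) (b j) = (k i)%:R * (c i j)%:~R.
Local Notation W := (fin_Weyl A b).
Implicit Types (u v t x y : 'I_n -> int).

Lemma even_obtuse i j : i != j -> form (b i) (b j) <= 0.
Proof. by move=> ij; rewrite formb; apply: mulr_ge0_le0; rewrite ?lerz0 ?c_le0. Qed.

(** The value of the coroot of [b i] on [comb b x], that is 2 (x, b_i) / (b_i, b_i), since b_i has
    norm 2 k_i. *)
Definition pairing x i : int := \sum_j c i j * x j.

Lemma form_comb_basis x i :
  form (comb b x) (b i) = (k i)%:R * (pairing x i)%:~R.
Proof.
rewrite (formC AF) form_combr rmorph_sum mulr_sumr; apply: eq_bigr => j _.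
by rewrite formb rmorphM /=; ring.
Qed.

Lemma basis_norm i : form (b i) (b i) = 2 * (k i)%:R.
Proof. by rewrite formb c_diag mulrC. Qed.

Lemma basis_norm_gt0 i : 0 < form (b i) (b i).
Proof. by rewrite basis_norm mulr_gt0 // ltr0n. Qed.

Lemma comb_single i z : comb b (fun j => if j == i then z else 0) = b i *~ z.
Proof.
rewrite /comb (bigD1 i) //= eqxx big1 ?addr0 // => j ji.
by rewrite (negPf ji) mulr0z.
Qed.

Lemma reflection_comb x i : reflection (b i) (comb b x) =
  comb b (fun j => x j - if j == i then pairing x i else 0).
Proof.
rewrite (combB b x) comb_single reflectionE -scaler_int; congr (_ - _ *: _).
rewrite form_comb_basis basis_norm; field.
by rewrite pnatr_eq0 -lt0n k_gt0.
Qed.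

Lemma form_comb_int x y : form (comb b x) (comb b y) \is a Num.int.
Proof.
rewrite form_combr rpred_sum // => i _; rewrite form_comb_basis.
by rewrite !rpredM ?intr_int ?natr_int.
Qed.

(** The generators have norm 2 k_i, and the cross term 2 (v, w) of a sum is even by integrality. *)
Lemma form_comb_even x : exists m : int, form (comb b x) (comb b x) = 2 * m%:~R.
Proof.
pose P (v : V) := (exists y, v = comb b y) /\ exists m : int, form v v = 2 * m%:~R.
suff [] : P (comb b x) by [].
apply: (big_ind P) => [|v w [[xv ->] [mv vv]] [[xw ->] [mw ww]]|i _].
- split; last by exists 0; rewrite form0l mulr0.
  by exists (fun=> 0); rewrite /comb big1.
- split.
    exists (fun i => xv i - - xw i); rewrite combB; congr (_ + _).
    by rewrite /comb -sumrN; apply: eq_bigr => i _; rewrite mulrNz opprK.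
  have /intrP [mvw vw] := form_comb_int xv xw.
  exists (mv + mw + mvw); rewrite !formE vv ww (formC AF (comb b xw)) vw.
  by rewrite !rmorphD /=; ring.
- split; first by exists (fun j => if j == i then x i else 0); rewrite comb_single.
  exists ((k i)%:Z * x i * x i); rewrite -scaler_int !formE basis_norm.
  by rewrite !rmorphM /=; ring.
Qed.

Lemma even_min_norm x : comb b x != 0 -> 2 <= form (comb b x) (comb b x).
Proof.
move=> x0; have [m mE] := form_comb_even x.
have := fin_gt0 AF (comb_fin bfin x) x0; rewrite mE pmulr_rgt0 // ltr0z => m0.
by rewrite ler_peMr // ler1z; lia.
Qed.

(** Otherwise the vector is u - v with u, v nonzero and (u, v) <= 0, of norm at least 2 + 2. *)
Lemma norm2_sign x : form (comb b x) (comb b x) = 2 ->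
  (forall i, 0 <= x i) \/ (forall i, x i <= 0).
Proof.
move=> x2; have [/(comb_eq0 bfree) u0|u0] := eqVneq (comb b (ppart x)) 0.
  by right=> i; have := u0 i; rewrite /ppart; lia.
have [/(comb_eq0 bfree) v0|v0] := eqVneq (comb b (npart x)) 0.
  by left=> i; have := v0 i; rewrite /npart; lia.
have uv := obtuse_form even_obtuse (ppart_ge0 x) (npart_ge0 x) (part_mul0 x).
move: x2 (even_min_norm u0) (even_min_norm v0) uv; rewrite ppartB !formE.
by rewrite (formC AF (comb b (npart x)) (comb b (ppart x))); lra.
Qed.

(** Reflecting in a [b i] with positive pairing lowers the height, and the descent can only stop at
    a simple vector. The clause [k i = 1] later identifies that vector A_i with a simple root. *)
Lemma norm2_orbit x : (forall i, 0 <= x i) -> form (comb b x) (comb b x) = 2 ->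
  exists w i, [/\ W w, comb b x = w (b i) & k i = 1%N].
Proof.
move=> x0 x2; have [N] : exists N : nat, \sum_i x i < N%:Z.
  by exists (absz (\sum_i x i)).+1; lia.
elim: N x x0 x2 => [|N IHN] x x0 x2 ltN.
  by move: ltN; rewrite ltNge sumr_ge0.
(* If there were none, every term x_i (b_i, x) of the norm would be nonpositive. *)
have [i /andP[xi xbi]] : exists i, (0 < x i) && (0 < form (b i) (comb b x)).
  apply/existsP; apply: contraPT x2; rewrite negb_exists => /forallP nx.
  rewrite form_combl; apply/eqP; rewrite lt_eqF //.
  apply: (@le_lt_trans _ _ 0) => //; apply: sumr_le0 => i _.
  have := nx i; rewrite negb_and -!leNgt => /orP[xi|xbi].
    have -> : x i = 0 by have := x0 i; lia.
    by rewrite mul0r.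
  by apply: mulr_ge0_le0; rewrite ?ler0z.
have z0 : 0 < pairing x i.
  by move: xbi; rewrite (formC AF) form_comb_basis pmulr_rgt0 ?ltr0n // ltr0z.
have := reflection_comb x i; set x' := (fun j => x j - _) => sx.
have x'2 : form (comb b x') (comb b x') = 2 by rewrite -sx reflection_form.
have [x'0|x'0] := norm2_sign x'2.
  have [|w [j [Ww x'w kj]]] := IHN x' x'0 x'2.
    rewrite sumrB [X in _ - X](bigD1 i) //= eqxx [X in _ - (_ + X)]big1.
      by move: ltN; set s := \sum_(j < n) x j; lia.
    by move=> j /negPf ->.
  exists (reflection (b i) \o w), j; split=> //=.
    by apply: fin_Weyl_comp => //; apply: fin_Weyl_refl.
  by rewrite -x'w -sx reflectionK.
(* Only coefficient i changes under the reflection, so a change of sign leaves no other coefficient.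
   The norm is then 2 k_i x_i^2. *)
have xE : comb b x = b i *~ x i.
  rewrite -comb_single; congr comb; apply/funext => j.
  have [->//|ji] := eqVneq j i.
  by have := x'0 j; have := x0 j; rewrite /x' (negPf ji); lia.
have x1 : (k i)%:Z * (x i * x i) = 1.
  apply/eqP; rewrite -(eqr_int R) !rmorphM /=; apply/eqP.
  move: x2; rewrite xE -scaler_int !formE basis_norm; lra.
have [ki x1i] : k i = 1%N /\ x i = 1 by have := k_gt0 i; nia.
by exists id, i; rewrite xE x1i; split=> //; apply: fin_Weyl_id.
Qed.

(* Let I be the set of j with b j orthogonal to the orbit of comb t.  Then I is
   orthogonal to its complement, so the part of comb t supported on I is
   isotropic, and I is empty. *)
Lemma orbit_nonorthogonal t i : (forall i, 0 < t i) ->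
  exists2 w, W w & form (w (comb b t)) (b i) <> 0.
Proof.
move=> t0; apply: contrapT => noW.
pose I j := `[< forall w, W w -> form (w (comb b t)) (b j) = 0 >].
have Ii : I i by apply/asboolP => w Ww; apply: contrapT => ?; apply: noW; exists w.
have IJ j l : I j -> ~~ I l -> form (b l) (b j) = 0.
  move=> /asboolP Ij; apply: contraNeq => lj; apply/asboolP => w Ww.
  have Ww' : W (reflection (b l) \o w).
    by apply: fin_Weyl_comp => //; apply: fin_Weyl_refl.
  (* Moving the reflection to the other argument replaces b_j by b_j minus a nonzero multiple of
     b_l, so (w t, b_l) vanishes too. *)
  have := Ij _ Ww'; rewrite -(reflection_form AF (b l)) /= reflectionK.
  rewrite reflectionE !formE Ij // add0r => /eqP.
  rewrite oppr_eq0 !mulf_eq0 pnatr_eq0 invr_eq0 (formC AF (b j)) (negPf lj).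
  by rewrite (gt_eqF (basis_norm_gt0 l)) /= => /eqP.
pose tI j := if I j then t j else 0; pose tJ j := if I j then 0 else t j.
have tE : comb b t = comb b tI + comb b tJ.
  rewrite /comb -big_split /=; apply: eq_bigr => j _; rewrite -mulrzDr /tI /tJ.
  by case: (I j); rewrite ?addr0 ?add0r.
have tI0 : comb b tI = 0.
  apply: (fin_anisotropic AF); first exact: comb_fin.
  rewrite form_combr big1 // => j _; rewrite /tI.
  case: ifP => [Ij|_]; last by rewrite mul0r.
  have -> : comb b (fun j => if I j then t j else 0) = comb b t - comb b tJ.
    by rewrite tE addrK.
  rewrite !formE (asboolP _ Ij id) ?sub0r; last exact: fin_Weyl_id.
  rewrite form_combl big1 ?oppr0 ?mulr0 // => l _; rewrite /tJ.
  by case: ifPn => [_|Jl]; rewrite ?mul0r // IJ ?mulr0.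
by have := comb_eq0 bfree tI0 i; have := t0 i; rewrite /tI Ii; lia.
Qed.

(** Some conjugate x of theta has nonzero pairing z with b_i, and x minus its reflection is z b_i,
    an element of N. Cauchy-Schwarz leaves only z = 1 or -1, or the equality case, where x itself is
    b_i or its opposite. *)
Lemma orbit_span (N : set V) t :
  (forall v w : V, N v -> N w -> N (v - w)) ->
  (forall i (v : V), N v -> N (reflection (b i) v)) ->
  (forall i, 0 < t i) -> form (comb b t) (comb b t) = 2 -> N (comb b t) ->
  forall i, N (b i).
Proof.
move=> NB NW t0 t2 Nt i; have N0 : N 0 by rewrite -(subrr (comb b t)); apply: NB.
have NN (v : V) : N v -> N (- v) by rewrite -sub0r; apply: NB.
have [w Ww wi] := orbit_nonorthogonal i t0.
have Nw : N (w (comb b t)) by apply: fin_Weyl_stable Ww Nt.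
have w2 : form (w (comb b t)) (w (comb b t)) = 2.
  by rewrite (iso_form (fin_Weyl_isometry AF bfin Ww)).
have [x xE] : exists x, w (comb b t) = comb b x.
  apply: (fin_Weyl_stable (P := [set v | exists x, v = comb b x]) _ Ww);
    last by exists t.
  move=> j _ [x ->]; rewrite reflection_comb.
  by exists (fun l => x l - if l == j then pairing x j else 0).
rewrite xE in Nw w2 wi.
have := NB _ _ Nw (NW i _ Nw).
rewrite reflection_comb combB comb_single opprB addrCA subrr addr0.
move: wi; rewrite form_comb_basis; set z := pairing x i => kz.
have z0 : z != 0 by apply/eqP => z0; apply: kz; rewrite z0 mulr0.
(* The component orthogonal to b_i; its norm 2 - k_i z^2 / 2 is nonnegative. *)
pose y := comb b x - (z%:~R / 2) *: b i.
have yfin : fin y by apply: finB; [exact: comb_fin|exact: finZ].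
have yy : form y y = 2 - (k i)%:R * z%:~R ^+ 2 / 2.
  rewrite !formE w2 (formC AF (b i)) form_comb_basis basis_norm -/z; lra.
have kz4 : (k i)%:Z * (z * z) <= 4.
  rewrite -(ler_int R) !rmorphM /=; have := fin_ge0 AF yfin; rewrite yy; lra.
have [->|->|[z2 ki]] : [\/ z = 1, z = -1 | `|z| = 2 /\ k i = 1%N].
- have := k_gt0 i; have [->|->|z2] : [\/ z = 1, z = -1 | 4 <= z * z].
  + have : `|z| = 1 \/ 2 <= `|z| by lia.
    move=> [z1|z2]; last by apply: Or33; nia.
    have [z1'|z1'] : z = 1 \/ z = -1 by lia.
      exact: Or31.
    exact: Or32.
  + by move=> _; apply: Or31.
  + by move=> _; apply: Or32.
  + by move=> ki; apply: Or33; split; nia.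
- by [].
- by rewrite mulrN1z => /NN; rewrite opprK.
- have y0 : y = 0.
    apply: (fin_anisotropic AF) => //; rewrite yy ki -rmorphXn /=.
    have -> : z ^+ 2 = 4 by nia.
    by lra.
  have /subr0_eq xb := y0.
  have [z2'|z2'] : z = 2 \/ z = -2 by lia.
    by move: Nw; rewrite xb z2' divff ?pnatr_eq0 // scale1r.
  move: (NN _ Nw); by rewrite xb z2' mulrNz mulNr divff ?pnatr_eq0 // scaleN1r opprK.
Qed.

End EvenLattice.

(** * Affine Weyl groups *)

Lemma comb_closed (V : zmodType) (N : set V) m (v : 'I_m -> V) c :
  N 0 -> (forall x y, N x -> N y -> N (x - y)) ->
  (forall i, N (v i)) -> N (comb v c).
Proof.
move=> N0 NB Nv; have NN x : N x -> N (- x) by rewrite -sub0r; apply: NB.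
have ND x y : N x -> N y -> N (x + y).
  by move=> Nx /NN Ny; rewrite -[y]opprK; apply: NB.
have Nn x k : N x -> N (x *+ k).
  by move=> Nx; elim: k => [|k IHk]; rewrite ?mulr0n // mulrS; apply: ND.
apply: (big_ind N) => // i _; case: (c i) => k; first exact: Nn.
by rewrite NegzE mulrNz; apply: NN; apply: Nn.
Qed.

Section Translation.
Variables (R : realType) (n : nat) (A : 'M[int]_n.+1).
Hypothesis AF : affine_form R A.
Local Notation V := (hstar R n).
Local Notation form := (@Defs.form R n A).
Local Notation reflection := (@reflection R n A).
Local Notation delta := (delta R A).
Local Notation Lambda0 := (Lambda0 R n).
Local Notation lambda := (@lambda R n A).
Implicit Types mu nu x y : V.

Lemma lambda_id : lambda 0 = id.
Proof.
by apply/funext => x; rewrite /Defs.lambda scaler0 !form0r !mul0r !addr0 scale0r subr0.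
Qed.

Lemma lambdaD mu nu : fin mu -> fin nu ->
  lambda mu \o lambda nu = lambda (mu + nu).
Proof.
move=> fmu fnu; apply/funext => x; rewrite /= /Defs.lambda !formE.
rewrite (formC AF delta mu) (fin_delta AF fmu) (fin_delta AF fnu).
rewrite (form_delta_delta AF) (formC AF nu mu).
by apply/matrixP => i j; rewrite !mxE; field.
Qed.

Lemma lambdaK mu : fin mu -> cancel (lambda mu) (lambda (- mu)).
Proof.
move=> fmu x; have := lambdaD (finN fmu) fmu.
by rewrite addNr lambda_id => /(congr1 (fun f => f x)).
Qed.

Lemma lambdaVK mu : fin mu -> cancel (lambda (- mu)) (lambda mu).
Proof. by move=> fmu; rewrite -{2}[mu]opprK; apply: lambdaK; apply: finN. Qed.

Lemma lambda_conj w mu : fin_isometry A w -> w \o lambda mu = lambda (w mu) \o w.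
Proof.
move=> [wD wZ wf wd wL]; apply/funext => x; rewrite /= /Defs.lambda.
have wxd : form (w x) delta = form x delta by rewrite -{1}wd wf.
by rewrite -scaleNr !wD !wZ wd wxd !wf scaleNr.
Qed.

Lemma lambda_delta mu : fin mu -> lambda mu delta = delta.
Proof.
move=> fmu; rewrite /Defs.lambda (formC AF delta mu) (fin_delta AF fmu).
by rewrite (form_delta_delta AF) mulr0 addr0 !scale0r addr0 subr0.
Qed.

Lemma lambda_fin mu x : fin x -> lambda mu x = x - form x mu *: delta.
Proof.
by move=> fx; rewrite /Defs.lambda (fin_delta AF fx) mulr0 addr0 scale0r addr0.
Qed.

Lemma lambda_Lambda mu : fin mu ->
  lambda mu Lambda0 = Lambda0 + mu - (form mu mu / 2) *: delta.
Proof.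
move=> fmu; rewrite /Defs.lambda (form_Lambda_delta AF) (fin_Lambda _ fmu).
by rewrite scale1r mulr1 add0r.
Qed.

Lemma lambdaDr mu x y : lambda mu (x + y) = lambda mu x + lambda mu y.
Proof. by apply/matrixP => i j; rewrite /Defs.lambda !formE !mxE; ring. Qed.

Lemma lambdaZr mu a x : lambda mu (a *: x) = a *: lambda mu x.
Proof. by apply/matrixP => i j; rewrite /Defs.lambda !formE !mxE; ring. Qed.

Lemma affine_reflection th : fin th -> form th th = 2 ->
  reflection (delta - th) = lambda th \o reflection th.
Proof.
move=> fth th2; apply/funext => x.
rewrite /= !reflectionE /Defs.lambda !formE th2 (form_delta_delta AF).
rewrite (formC AF delta th) (fin_delta AF fth).
by apply/matrixP => i j; rewrite !mxE; field.
Qed.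

Lemma reflection_conj w w' a : fin_isometry A w -> cancel w' w ->
  reflection (w a) = w \o reflection a \o w'.
Proof.
move=> [wD wZ wf _ _] w'w; apply/funext => x; rewrite /= !reflectionE.
by rewrite -[in RHS]scaleNr wD wZ w'w scaleNr -{2}(w'w x) !wf.
Qed.

Lemma fin_Weyl_scale (e : 'I_n -> R) (b : 'I_n -> V) : (forall i, e i != 0) ->
  fin_Weyl A (fun i => e i *: b i) = fin_Weyl A b.
Proof.
move=> e0; congr generated; congr image.
by apply/funext => i; rewrite reflectionZ.
Qed.

Section AffineWeyl.
Variables (Av : 'I_n -> V) (k : 'I_n -> nat) (c : 'I_n -> 'I_n -> int).
Hypothesis Afin : forall i, fin (Av i).
Hypothesis Afree : forall u : 'I_n -> R,
  \sum_i u i *: Av i = 0 -> forall i, u i = 0.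
Hypothesis k_gt0 : forall i, (0 < k i)%N.
Hypothesis c_diag : forall i, c i i = 2.
Hypothesis c_le0 : forall i j, i != j -> c i j <= 0.
Hypothesis formA : forall i j, form (Av i) (Av j) = (k i)%:R * (c i j)%:~R.
Variable t : 'I_n -> int.
Hypothesis t_gt0 : forall i, 0 < t i.
Hypothesis t_norm : form (comb Av t) (comb Av t) = 2.
Variable al : 'I_n.+1 -> V.
Hypothesis al0 : al ord0 = delta - comb Av t.
Hypothesis alR : forall i, reflection (fin_simple al i) = reflection (Av i).

Lemma int_span_stable w x : fin_Weyl A Av w -> int_span Av x -> int_span Av (w x).
Proof.
apply: fin_Weyl_stable => i _ [d ->]; rewrite (reflection_comb AF k_gt0 c_diag formA d).
by eexists.
Qed.

Lemma int_span_fin x : int_span Av x -> fin x.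
Proof. by move=> [d ->]; apply: comb_fin. Qed.

(** The finite simple roots enter only through their reflections ([alR]), since they are merely
    proportional to the [Av i]. *)
Lemma WeylE : Weyl A al =
  [set f | exists mu w, [/\ int_span Av mu, fin_Weyl A Av w & f = lambda mu \o w]].
Proof.
set H := [set f | _]; pose th := comb Av t.
have th2 : form th th = 2 by [].
have fth : fin th by apply: comb_fin.
have HE mu w : int_span Av mu -> fin_Weyl A Av w -> H (lambda mu \o w).
  by exists mu, w.
have iso := fin_Weyl_isometry AF Afin.
have S0 : int_span Av 0 by exists (fun=> 0); rewrite big1.
have SB x y : int_span Av x -> int_span Av y -> int_span Av (x - y).
  by move=> [d ->] [d' ->]; exists (fun i => d i - d' i); symmetry; apply: combB.
have SN x : int_span Av x -> int_span Av (- x) by rewrite -sub0r; apply: SB.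
(* Theta is conjugate to some [Av i0], so its reflection is a conjugate of a simple one. *)
have [w0 [i0 [Ww thE ki0]]] := norm2_orbit AF Afin Afree k_gt0 c_diag c_le0 formA
  (fun i => ltW (t_gt0 i)) t_norm.
have Wth : fin_Weyl A Av (reflection th).
  have [w' [Ww' ww' w'w]] := fin_Weyl_inverse Ww.
  rewrite /th thE (reflection_conj _ (iso _ Ww) w'w).
  by apply: fin_Weyl_comp => //; apply: fin_Weyl_comp => //; apply: fin_Weyl_refl.
have [W1 WM WV] := generated_subgroup [set reflection (al j) | j in [set: 'I_n.+1]].
have finW : fin_Weyl A Av `<=` Weyl A al.
  apply: generated_min; first exact: generated_subgroup.
  by move=> _ [i _ <-]; rewrite -alR; apply: generated_gen; exists (lift ord0 i).
apply/seteqP; split.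
  apply: generated_min.
    split.
    - by rewrite -lambda_id; apply: (HE 0 id) => //; apply: fin_Weyl_id.
    - move=> _ _ [mu [v [Mmu Wv ->]]] [nu [w [Mnu Ww' ->]]].
      have -> : (lambda mu \o v) \o (lambda nu \o w) =
          lambda (mu + v nu) \o (v \o w).
        rewrite -lambdaD.
        - apply/funext => x /=.
          rewrite -[v (lambda _ _)]/((v \o lambda nu) (w x)).
          by rewrite (lambda_conj _ (iso _ Wv)).
        - exact: int_span_fin.
        - by apply: (iso_fin AF (iso _ Wv)); apply: int_span_fin.
      apply: HE; last exact: fin_Weyl_comp.
      by rewrite -[v nu]opprK; apply: SB => //; apply: SN; apply: int_span_stable.
    - move=> _ g [mu [w [Mmu Ww' ->]]] fg gf.
      have [w' [Ww'' ww' w'w]] := fin_Weyl_inverse Ww'.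
      have -> : g = lambda (- w' mu) \o w'.
        rewrite -scaleN1r -(isoZ (iso _ Ww'')) scaleN1r -lambda_conj; last exact: iso.
        apply/funext => x /=; rewrite -[RHS]fg /= w'w lambdaVK //.
        exact: int_span_fin.
      by apply: HE => //; apply: SN; apply: int_span_stable.
  move=> _ [j _ <-]; case: (unliftP ord0 j) => [i ->|->].
    rewrite -[al _]/(fin_simple al i) alR -[reflection _]/(id \o reflection (Av i)).
    by rewrite -lambda_id; apply: HE => //; apply: fin_Weyl_refl.
  by rewrite al0 affine_reflection //; apply: HE => //; exists t.
move=> _ [mu [w [[d ->] Ww' ->]]]; apply: (WM _ _ _ (finW _ Ww')).
(* The translations lying in the Weyl group form a lattice stable under the finite Weyl group and
   containing theta, so [orbit_span] applies. *)
pose N := [set v : V | fin v /\ Weyl A al (lambda v)].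
suff [] : N (comb Av d) by [].
have NB v v' : N v -> N v' -> N (v - v').
  move=> [fv Wv] [fv' Wv']; split; first exact: finB.
  rewrite -lambdaD //; last exact: finN.
  by apply: WM => //; apply: WV Wv' _ _; [exact: lambdaK|exact: lambdaVK].
have N0 : N 0 by split; [exact: fin0|rewrite lambda_id; exact: W1].
apply: comb_closed => //.
apply: (orbit_span AF Afin Afree k_gt0 c_diag formA NB _ t_gt0 t_norm).
  move=> i v [fv Wv]; have si := reflection_fin_isometry AF (Afin i).
  have Wi : Weyl A al (reflection (Av i)) by apply: finW; apply: fin_Weyl_refl.
  split; first exact: (iso_fin AF si fv).
  have -> : lambda (reflection (Av i) v) =
      reflection (Av i) \o lambda v \o reflection (Av i).
    by rewrite lambda_conj //; apply/funext => x /=; rewrite reflectionK.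
  by apply: (WM) => //; apply: WM.
split=> //; have -> : lambda th = reflection (delta - th) \o reflection th.
  by rewrite affine_reflection //; apply/funext => x /=; rewrite reflectionK.
apply: WM; last exact: finW.
by rewrite -al0; apply: generated_gen; exists ord0.
Qed.

End AffineWeyl.
End Translation.

(** * Double affine Weyl groups *)

Section DoubleAffineWeyl.
Variables (R : realType) (n : nat) (A : 'M[int]_n.+1).
Hypothesis AF : affine_form R A.
Local Notation V := (hstar R n).
Local Notation form := (@Defs.form R n A).
Local Notation delta := (delta R A).
Local Notation Lambda0 := (Lambda0 R n).
Local Notation lambda := (@lambda R n A).
Implicit Types (mu b x : V) (w : V -> V).

(** What the construction of phi asks of R and its image under iota, to be used in both directions
    with the same [p]. By [dual_int] the coefficient (mu, b) of delta in phi is an integer. *)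
Record dual_systems (p : R) (al ali : 'I_n.+1 -> V) : Prop := DualSystems {
  dual_gt0 : 0 < p;
  dual_pnum : pnum A al = p;
  dual_iota : iota_root A al = ali;
  dual_fin : forall i, fin (fin_simple al i);
  dual_fin_Weyl : fin_Weyl A (fin_simple ali) = fin_Weyl A (fin_simple al);
  dual_M : Mlattice A ali = [set Num.sqrt p *: b | b in fin_Qlattice al];
  dual_Weyl : Weyl A al = [set f | exists mu w,
    [/\ Mlattice A al mu, fin_Weyl A (fin_simple al) w & f = lambda mu \o w]];
  dual_int : forall mu b, Mlattice A al mu -> fin_Qlattice al b ->
    form mu b \is a Num.int }.

(** Projection along delta of [fin] plus the line of delta: as a_0 = 1, the coefficient of delta is
    the alpha_0 coordinate. *)
Definition fin_part x : V := x - x 0 (lshift 1 ord0) *: delta.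

Lemma fin_partE b c : fin b -> fin_part (b + c *: delta) = b.
Proof.
move=> [b0 _]; rewrite /fin_part !mxE b0 (delta_alpha0 AF) mulr1 add0r.
exact: addrK.
Qed.

(** On (b + c delta, lambda_mu w), the part w fixes [Lambda0], so mu is the finite part of the
    displacement of [Lambda0]. Composing with [lambda (- mu)] then recovers w. *)
Definition phi_map (p : R) (g : V * (V -> V)) : V * (V -> V) :=
  let mu := fin_part (g.2 Lambda0 - Lambda0) in
  let b := fin_part g.1 in
  ((Num.sqrt p)^-1 *: mu - (g.1 0 (lshift 1 ord0) + form mu b) *: delta,
   lambda (Num.sqrt p *: b) \o lambda (- mu) \o g.2).

Lemma phi_mapE p b c mu w : fin b -> fin mu -> fin_isometry A w ->
  phi_map p (b + c *: delta, lambda mu \o w) =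
  ((Num.sqrt p)^-1 *: mu - (c + form mu b) *: delta, lambda (Num.sqrt p *: b) \o w).
Proof.
move=> fb fmu iw; rewrite /phi_map /= (iso_Lambda iw) (lambda_Lambda AF fmu).
have -> : Lambda0 + mu - (form mu mu / 2) *: delta - Lambda0 =
    mu + (- (form mu mu / 2)) *: delta.
  by rewrite scaleNr addrAC [Lambda0 + mu]addrC addrK.
rewrite !fin_partE //; congr (_ - (_ + _) *: _, _).
  by case: fb => b0 _; rewrite !mxE b0 (delta_alpha0 AF) mulr1 add0r.
by apply/funext => x /=; rewrite lambdaK.
Qed.

(** This is [dual_M] of the reversed pair, divided by sqrt p. *)
Lemma fin_Qlattice_dual p al ali : dual_systems p al ali ->
  dual_systems p ali al ->
  fin_Qlattice ali = [set (Num.sqrt p)^-1 *: mu | mu in Mlattice A al].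
Proof.
move=> D D'; rewrite (dual_M D') image_comp.
have p0 : Num.sqrt p != 0 by rewrite gt_eqF // sqrtr_gt0 (dual_gt0 D).
rewrite -[LHS]image_id; congr image; apply/funext => x /=.
by rewrite scalerA mulVf // scale1r.
Qed.

Section DoubleWeyl.
Variables (p : R) (al ali : 'I_n.+1 -> V).
Hypothesis D : dual_systems p al ali.
Local Notation W := (fin_Weyl A (fin_simple al)).
Local Notation s := (Num.sqrt p).

Lemma sqrtp_neq0 : s != 0.
Proof. by rewrite gt_eqF // sqrtr_gt0 (dual_gt0 D). Qed.

Lemma fin_Qlattice_fin b : fin_Qlattice al b -> fin b.
Proof.
move=> [c ->]; apply: fin_sum => i _; rewrite -scaler_int.
by apply: finZ; apply: (dual_fin D).
Qed.

Lemma Mlattice_fin mu : Mlattice A al mu -> fin mu.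
Proof.
move=> [c ->]; apply: fin_sum => i _; rewrite -scaler_int.
by do 2 apply: finZ; apply: (dual_fin D).
Qed.

Lemma dual_fin_isometry w : W w -> fin_isometry A w.
Proof. exact: (fin_Weyl_isometry AF (dual_fin D)). Qed.

Lemma dWeylE g : dWeyl A al g <-> exists b (c : int) mu w,
  [/\ fin_Qlattice al b, Mlattice A al mu, W w &
      g = (b + c%:~R *: delta, lambda mu \o w)].
Proof.
case: g => x f; rewrite /dWeyl (dual_Weyl D) /=; split.
  move=> [[b Qb [c ->]] [mu [w [Mmu Ww ->]]]]; exists b, c, mu, w; split=> //.
  by rewrite scaler_int.
move=> [b [c [mu [w [Qb Mmu Ww [-> ->]]]]]]; split; last by exists mu, w.
by exists b => //; exists c; rewrite scaler_int.
Qed.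

Lemma Mlattice0 : Mlattice A al 0. Proof. by exists (fun=> 0); rewrite big1. Qed.
Lemma fin_Qlattice0 : fin_Qlattice al 0. Proof. by exists (fun=> 0); rewrite big1. Qed.

Lemma dWeyl_W w : W w -> dWeyl A al (ofWeyl w).
Proof.
move=> Ww; apply/dWeylE; exists 0, 0, 0, w.
split; [exact: fin_Qlattice0|exact: Mlattice0| |] => //.
by rewrite scale0r addr0 lambda_id.
Qed.

Lemma dWeyl_lambda mu : Mlattice A al mu -> dWeyl A al (ofWeyl (lambda mu)).
Proof.
move=> Mmu; apply/dWeylE; exists 0, 0, mu, id; split=> //; [exact: fin_Qlattice0| |].
  exact: fin_Weyl_id.
by rewrite scale0r addr0.
Qed.

Lemma dWeyl_tau b : fin_Qlattice al b -> dWeyl A al (tau b).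
Proof.
move=> Qb; apply/dWeylE; exists b, 0, 0, id; split=> //; [exact: Mlattice0| |].
  exact: fin_Weyl_id.
by rewrite scale0r addr0 lambda_id.
Qed.

Lemma dWeyl_delta (c : int) : dWeyl A al (tau (c%:~R *: delta)).
Proof.
apply/dWeylE; exists 0, c, 0, id; split=> //; [exact: fin_Qlattice0|exact: Mlattice0| |].
  exact: fin_Weyl_id.
by rewrite add0r lambda_id.
Qed.

End DoubleWeyl.

(** * Existence and uniqueness of phi *)

Section Phi.
Variables (p : R) (al ali : 'I_n.+1 -> V).
Hypotheses (D : dual_systems p al ali) (Di : dual_systems p ali al).
Local Notation W := (fin_Weyl A (fin_simple al)).
Local Notation s := (Num.sqrt p).

Lemma dual_scale mu : Mlattice A al mu -> fin_Qlattice ali (s^-1 *: mu).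
Proof.
rewrite (dual_M Di) => -[b Qb <-].
by rewrite scalerA mulVf ?scale1r // (sqrtp_neq0 D).
Qed.

Lemma phi_set_fun : set_fun (dWeyl A al) (dWeyl A ali) (phi_map p).
Proof.
move=> _ /(dWeylE D) [b [c [mu [w [Qb Mmu Ww ->]]]]].
rewrite phi_mapE; [|exact: (fin_Qlattice_fin D)|exact: (Mlattice_fin D)|
  exact: (dual_fin_isometry D)].
have /intrP [m ->] := dual_int D Mmu Qb.
apply/(dWeylE Di); exists (s^-1 *: mu), (- (c + m)), (s *: b), w; split.
- exact: dual_scale.
- by rewrite (dual_M D); exists b.
- by rewrite (dual_fin_Weyl D).
- by rewrite rmorphN rmorphD /= scaleNr.
Qed.

(** In the coefficient of delta, expanding (mu + w mu', b + w b') gives two cross terms. The term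
    (mu, w b') cancels the one made by lambda_mu in the source; (w mu', b) is made by lambda_{sqrt p
    b} in the target. *)
Lemma phi_mapM g h : dWeyl A al g -> dWeyl A al h ->
  phi_map p (dmul g h) = dmul (phi_map p g) (phi_map p h).
Proof.
move=> /(dWeylE D) [b [c [mu [w [Qb Mmu Ww ->]]]]].
move=> /(dWeylE D) [b' [c' [mu' [w' [Qb' Mmu' Ww' ->]]]]].
have fb := fin_Qlattice_fin D Qb; have fmu := Mlattice_fin D Mmu.
have iw := dual_fin_isometry D Ww.
have fb' := fin_Qlattice_fin D Qb'; have fmu' := Mlattice_fin D Mmu'.
have iw' := dual_fin_isometry D Ww'.
have fwb' := iso_fin AF iw fb'; have fwmu' := iso_fin AF iw fmu'.
have -> : dmul (b + c%:~R *: delta, lambda mu \o w)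
               (b' + c'%:~R *: delta, lambda mu' \o w') =
  ((b + w b') + (c%:~R + c'%:~R - form (w b') mu) *: delta,
   lambda (mu + w mu') \o (w \o w')).
  rewrite /dmul /= !(isoD iw) !(isoZ iw) (iso_delta iw) lambdaDr lambdaZr.
  rewrite (lambda_delta AF fmu) (lambda_fin AF _ fwb') -(lambdaD AF fmu fwmu').
  congr (_, _).
    by apply/matrixP => i j; rewrite !mxE; ring.
  apply/funext => x /=; congr (lambda mu _).
  by rewrite -[LHS]/((w \o lambda mu') (w' x)) (lambda_conj _ iw).
rewrite !phi_mapE //; [|exact: finD|exact: finD|exact: fin_isometry_comp].
rewrite /dmul /=; congr (_, _).
  rewrite -!scaleNr (isoD iw) !(isoZ iw) (iso_delta iw) lambdaDr !lambdaZr.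
  rewrite (lambda_delta AF (finZ _ fb)) (lambda_fin AF _ fwmu') !formE.
  rewrite (iso_form iw) (formC AF mu (w b')).
  have s0 := sqrtp_neq0 D.
  by apply/matrixP => i j; rewrite !mxE; field.
apply/funext => x /=; rewrite scalerDr -(lambdaD AF) /=; try exact: finZ.
congr (lambda (s *: b) _); rewrite -(isoZ iw).
by rewrite -[RHS]/((w \o lambda (s *: b')) (w' x)) (lambda_conj _ iw).
Qed.

Lemma phi_map_is_phi : is_phi A al (phi_map p).
Proof.
rewrite /is_phi (dual_iota D) (dual_pnum D).
split; [exact: phi_set_fun|exact: phi_mapM|].
have E b c mu w := @phi_mapE p b c mu w.
have I := fin_isometry_id R A; have F0 := @fin0 R n.
split=> [w Ww|mu Mmu|b Qb|].
- have := E 0 0 0 w F0 F0 (dual_fin_isometry D Ww).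
  rewrite lambda_id !scale0r scaler0 form0l !addr0 scale0r subr0 scaler0.
  by rewrite lambda_id.
- have := E 0 0 mu id F0 (Mlattice_fin D Mmu) I.
  by rewrite !scale0r form0r !addr0 scale0r subr0 scaler0 lambda_id.
- have := E b 0 0 id (fin_Qlattice_fin D Qb) F0 I.
  by rewrite lambda_id !scale0r scaler0 form0l !addr0 scale0r subr0.
- have := E 0 1 0 id F0 F0 I.
  by rewrite lambda_id scale1r !scaler0 form0l add0r addr0 scale1r sub0r lambda_id.
Qed.

Lemma is_phi_delta f : is_phi A al f ->
  forall c : int, f (tau (c%:~R *: delta)) = tau (- (c%:~R *: delta)).
Proof.
move=> [_ fM [fW _ _ fd]].
(* [tau 0] and [ofWeyl id] are the same pair. *)
have f1 : f (tau 0) = tau 0 by apply: fW; apply: fin_Weyl_id.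
have fnat (k : nat) : f (tau (k%:R *: delta)) = tau (- (k%:R *: delta)).
  elim: k => [|k IHk]; first by rewrite scale0r oppr0.
  have -> : tau (k.+1%:R *: delta) = dmul (tau delta) (tau (k%:R *: delta)).
    by rewrite /dmul /tau /= -nat1r scalerDl scale1r.
  rewrite fM ?IHk ?fd; last exact: (dWeyl_delta D k).
    by rewrite /dmul /tau /= -nat1r scalerDl scale1r opprD.
  by have := dWeyl_delta D 1; rewrite scale1r.
case=> k; first exact: fnat.
(* The image of a negative multiple is not known to be a translation; comparing its product with
   [tau 0] forces its second component to be [id]. *)
rewrite NegzE; have := fM _ _ (dWeyl_delta D (- k.+1%:Z)) (dWeyl_delta D k.+1).
rewrite [X in _ = dmul _ X]fnat /dmul /tau /= -scalerDl rmorphN addNr scale0r.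
rewrite -/(tau 0) f1 /=; case: (f _) => x h /= [/eqP xE hE].
have {}hE : h = id by rewrite hE; apply/funext.
by move: xE; rewrite hE /= eq_sym subr_eq0 => /eqP ->; rewrite scaleNr opprK.
Qed.

(** Every element is a product tau_b tau_{c delta} lambda_mu w of elements whose images are
    prescribed. *)
Lemma is_phi_unique f : is_phi A al f -> forall g, dWeyl A al g -> f g = phi_map p g.
Proof.
move=> Pf _ /(dWeylE D) [b [c [mu [w [Qb Mmu Ww ->]]]]].
have Pd := is_phi_delta Pf.
case: Pf; rewrite (dual_iota D) (dual_pnum D) => _ fM [fW fl ft _].
have fb := fin_Qlattice_fin D Qb; have fmu := Mlattice_fin D Mmu.
have iw := dual_fin_isometry D Ww.
rewrite phi_mapE //.
have lw : dWeyl A al (ofWeyl (lambda mu \o w)).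
  apply/(dWeylE D); exists 0, 0, mu, w; split=> //; first exact: fin_Qlattice0.
  by rewrite scale0r addr0.
have dlw : dWeyl A al (c%:~R *: delta, lambda mu \o w).
  apply/(dWeylE D); exists 0, c, mu, w; split=> //; first exact: fin_Qlattice0.
  by rewrite add0r.
have -> : (b + c%:~R *: delta, lambda mu \o w) =
    dmul (tau b) (c%:~R *: delta, lambda mu \o w) by [].
rewrite fM //; last exact: (dWeyl_tau D).
have -> : (c%:~R *: delta, lambda mu \o w) =
    dmul (tau (c%:~R *: delta)) (ofWeyl (lambda mu \o w)).
  by rewrite /dmul /= addr0.
rewrite fM //; last exact: (dWeyl_delta D).
have -> : ofWeyl (lambda mu \o w) = dmul (ofWeyl (lambda mu)) (ofWeyl w).
  by rewrite /dmul /= lambda_fin ?form0l ?scale0r ?subr0 ?addr0 //; exact: fin0.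
rewrite fM; [|exact: (dWeyl_lambda D)|exact: (dWeyl_W D)].
rewrite ft // Pd fl // fW // /dmul /= addr0 add0r; congr (_, _).
rewrite -scaleNr lambdaDr !lambdaZr (lambda_delta AF (finZ _ fb)).
rewrite (lambda_fin AF _ fmu) formZr; have s0 := sqrtp_neq0 D.
by apply/matrixP => i j; rewrite !mxE; field.
Qed.

End Phi.

(** The second application negates - (c + (mu, b)) + (sqrt p b, mu / sqrt p) = - c. *)
Lemma phi_mapK p al ali : dual_systems p al ali -> dual_systems p ali al ->
  forall g, dWeyl A al g -> phi_map p (phi_map p g) = g.
Proof.
move=> D Di g /(dWeylE D) [b [c [mu [w [Qb Mmu Ww ->]]]]].
have fb := fin_Qlattice_fin D Qb; have fmu := Mlattice_fin D Mmu.
have iw := dual_fin_isometry D Ww.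
rewrite phi_mapE // -scaleNr phi_mapE ?finZ //; try exact: finZ.
rewrite !formE (formC AF b mu) !scalerA.
have s0 := sqrtp_neq0 D; rewrite mulVf // mulfV // !scale1r.
congr (_ , _); rewrite mulrA mulfV // mul1r opprD addrNK ?scaleNr ?opprK //.
Qed.

End DoubleAffineWeyl.

(** * Root data and labels *)

Lemma is_labels_intro (R : realType) m (C : 'M[R]_m.+1) (a : 'I_m.+1 -> nat) :
  a ord0 = 1%N -> (forall k, (0 < a k)%N) ->
  (forall j, \sum_k C j k * (a k)%:R = 0) -> is_labels C a.
Proof.
move=> a0 apos Ca; split=> //; apply/eqP; rewrite -dvdn1 -a0.
exact: biggcdn_inf (dvdnn _).
Qed.

(** The labels are the multiple of [a] by their entry at 0, which divides their gcd 1. *)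
Lemma labels_unique (R : realType) m (C : 'M[R]_m.+1) (a : 'I_m.+1 -> nat) :
  a ord0 = 1%N -> is_labels C a ->
  (forall v : 'I_m.+1 -> R, (forall j, \sum_k C j k * v k = 0) ->
     forall k, v k = v ord0 * (a k)%:R) ->
  labels C = a.
Proof.
move=> a0 aC ker; have [lpos lgcd lC] : is_labels C (labels C).
  exact: (xgetPex (fun=> 1%N) (ex_intro [set l | is_labels C l] a aC)).
have lE k : labels C k = (labels C ord0 * a k)%N.
  apply/eqP; rewrite -(eqr_nat R) natrM; apply/eqP.
  exact: (ker (fun k => (labels C k)%:R)).
have l1 : labels C ord0 = 1%N.
  apply/eqP; rewrite -dvdn1 -lgcd; apply/dvdn_biggcdP => k _.
  by rewrite [X in (_ %| X)%N]lE dvdn_mulr.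
by apply/funext => k; rewrite lE l1 mul1n.
Qed.

Section RootDatum.
Variables (R : realType) (n : nat) (A : 'M[int]_n.+1).
Hypothesis AF : affine_form R A.
Local Notation V := (hstar R n).
Local Notation form := (@Defs.form R n A).
Local Notation reflection := (@reflection R n A).
Local Notation delta := (delta R A).
Implicit Types (b : 'I_n -> V) (e f t : 'I_n -> nat) (c : 'I_n -> 'I_n -> int).

Definition scaled b e i : V := (e i)%:R *: b i.

(* The simple roots b_i of a finite root system with Cartan matrix c, where
   d_i = e_i / f_i, so that [scaled b e] is the family A_i, together with the
   root theta = sum_i t_i A_i. *)
Record root_datum b e f c t : Prop := RootDatum {
  rd_scale : forall i, exists2 r : R, 0 < r & b i = r *: alpha R (lift ord0 i);
  rd_e : forall i, (0 < e i)%N;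
  rd_f : forall i, (0 < f i)%N;
  rd_ef : forall i, e i = 1%N \/ f i = 1%N;
  rd_diag : forall i, c i i = 2;
  rd_le0 : forall i j, i != j -> c i j <= 0;
  rd_form : forall i j, form (b i) (b j) = (f i)%:R / (e i)%:R * (c i j)%:~R;
  rd_dvd : forall i j, ((e i)%:Z %| (e j)%:Z * c i j)%Z;
  rd_t : forall i, (0 < t i)%N;
  rd_norm : form (comb (scaled b e) (Posz \o t)) (comb (scaled b e) (Posz \o t)) = 2;
  rd_dom : forall i, 0 <= form (comb (scaled b e) (Posz \o t)) (b i) }.

Section Datum.
Variables (b : 'I_n -> V) (e f : 'I_n -> nat) (c : 'I_n -> 'I_n -> int).
Variable t : 'I_n -> nat.
Hypothesis D : root_datum b e f c t.
Local Notation Av := (scaled b e).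
Local Notation theta := (comb Av (Posz \o t)).

(** The Cartan matrix of the family A_i; the division is exact by [rd_dvd]. *)
Definition scaled_cartan i j : int := (((e j)%:Z * c i j) %/ (e i)%:Z)%Z.

Lemma e_neq0 i : (e i)%:R != 0 :> R.
Proof. by rewrite pnatr_eq0 -lt0n (rd_e D). Qed.

Lemma f_neq0 i : (f i)%:R != 0 :> R.
Proof. by rewrite pnatr_eq0 -lt0n (rd_f D). Qed.

Lemma datum_fin i : fin (b i).
Proof. by have [r _ ->] := rd_scale D i; apply: finZ; apply: fin_alpha. Qed.

Lemma datum_free (u : 'I_n -> R) : \sum_i u i *: b i = 0 -> forall i, u i = 0.
Proof.
move=> u0 i; have [r r0 bE] : exists2 r : 'I_n -> R, (forall i, 0 < r i) &
    forall i, b i = r i *: alpha R (lift ord0 i).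
  have [r rE] := choice (fun i => let: ex_intro2 r r0 bE := rd_scale D i in
    ex_intro (fun r => 0 < r /\ b i = r *: alpha R (lift ord0 i)) r (conj r0 bE)).
  by exists r => j; case: (rE j).
have /eqP : u i * r i = 0.
  apply: (alpha_free (u := fun i => u i * r i)); rewrite -[RHS]u0.
  by apply: eq_bigr => j _; rewrite bE scalerA.
by rewrite mulf_eq0 (gt_eqF (r0 i)) orbF => /eqP.
Qed.

Lemma scaled_fin i : fin (Av i).
Proof. exact/finZ/datum_fin. Qed.

Lemma scaled_free (u : 'I_n -> R) : \sum_i u i *: Av i = 0 -> forall i, u i = 0.
Proof.
move=> u0 i; have /eqP : u i * (e i)%:R = 0.
  apply: (datum_free (u := fun i => u i * (e i)%:R)); rewrite -[RHS]u0.
  by apply: eq_bigr => j _; rewrite scalerA.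
by rewrite mulf_eq0 (negPf (e_neq0 i)) orbF => /eqP.
Qed.

Lemma scaled_cartanE i j : (e i)%:Z * scaled_cartan i j = (e j)%:Z * c i j.
Proof. by rewrite mulrC /scaled_cartan divzK // (rd_dvd D). Qed.

Lemma scaled_gt0 i : (0 < e i * f i)%N.
Proof. by rewrite muln_gt0 (rd_e D) (rd_f D). Qed.

Lemma scaled_diag i : scaled_cartan i i = 2.
Proof.
apply: (@mulfI _ (e i)%:Z); first by have := rd_e D i; lia.
by rewrite scaled_cartanE (rd_diag D).
Qed.

Lemma scaled_le0 i j : i != j -> scaled_cartan i j <= 0.
Proof.
move=> ij; have := scaled_cartanE i j; have := rd_le0 D ij.
by have := rd_e D i; have := rd_e D j; nia.
Qed.

Lemma scaled_form i j :
  form (Av i) (Av j) = (e i * f i)%:R * (scaled_cartan i j)%:~R.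
Proof.
rewrite !formE (rd_form D) natrM.
rewrite [RHS](_ : _ = (f i)%:R * ((e i)%:R * (scaled_cartan i j)%:~R)); last by ring.
have -> : (e i)%:R * (scaled_cartan i j)%:~R = (e j)%:R * (c i j)%:~R :> R.
  by have := congr1 (intr : int -> R) (scaled_cartanE i j); rewrite !rmorphM.
by have ei := e_neq0 i; field.
Qed.

Lemma datum_norm i : form (b i) (b i) = 2 * (f i)%:R / (e i)%:R.
Proof. by rewrite (rd_form D) (rd_diag D) mulrC mulrA. Qed.

Lemma scaled_t i : 0 < (t i)%:Z.
Proof. by have := rd_t D i; lia. Qed.

Lemma theta_fin : fin theta.
Proof. exact: comb_fin scaled_fin _. Qed.

Lemma thetaE : theta = \sum_i (e i * t i)%:R *: b i.
Proof.
by apply: eq_bigr => i _; rewrite -scaler_int scalerA natrM mulrC.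
Qed.

Section Affine.
Variable al : 'I_n.+1 -> V.
Hypothesis al0 : al ord0 = delta - theta.
Hypothesis alb : forall i, al (lift ord0 i) = b i.

Lemma fin_simpleE : fin_simple al = b.
Proof. exact/funext. Qed.

(** Kac's marks and comarks: shown below to be the labels of the Cartan matrix of [al] and of its
    transpose. *)
Definition mark (j : 'I_n.+1) : nat :=
  if unlift ord0 j is Some i then (e i * t i)%N else 1%N.
Definition comark (j : 'I_n.+1) : nat :=
  if unlift ord0 j is Some i then (f i * t i)%N else 1%N.

Lemma mark0 : mark ord0 = 1%N. Proof. by rewrite /mark unlift_none. Qed.
Lemma markS i : mark (lift ord0 i) = (e i * t i)%N.
Proof. by rewrite /mark liftK. Qed.
Lemma comark0 : comark ord0 = 1%N. Proof. by rewrite /comark unlift_none. Qed.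
Lemma comarkS i : comark (lift ord0 i) = (f i * t i)%N.
Proof. by rewrite /comark liftK. Qed.

Lemma sum_mark : \sum_j (mark j)%:R *: al j = delta.
Proof.
rewrite big_ord_recl mark0 scale1r al0 thetaE addrC.
by under eq_bigr => i _ do rewrite markS alb; rewrite addrC subrK.
Qed.

Lemma al_delta j : form (al j) delta = 0.
Proof.
case: (unliftP ord0 j) => [i ->|->]; first by rewrite alb (fin_delta AF (datum_fin i)).
by rewrite al0 !formE (form_delta_delta AF) (fin_delta AF theta_fin) subr0.
Qed.

(** Half the norm of a simple root is the ratio of comark to mark, that is 1 / d_j; at vertex 0 this
    uses that theta has norm 2. *)
Lemma al_norm j : form (al j) (al j) / 2 * (mark j)%:R = (comark j)%:R.
Proof.
case: (unliftP ord0 j) => [i ->|->]; last first.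
  rewrite al0 !formE (form_delta_delta AF) (formC AF delta) (rd_norm D).
  by rewrite (fin_delta AF theta_fin) mark0 comark0; lra.
rewrite alb markS comarkS datum_norm !natrM.
by have ei := e_neq0 i; field.
Qed.

Lemma mark_gt0 j : (0 < mark j)%N.
Proof.
case: (unliftP ord0 j) => [i ->|->]; rewrite ?mark0 // markS.
by rewrite muln_gt0 (rd_e D) (rd_t D).
Qed.

Lemma comark_gt0 j : (0 < comark j)%N.
Proof.
case: (unliftP ord0 j) => [i ->|->]; rewrite ?comark0 // comarkS.
by rewrite muln_gt0 (rd_f D) (rd_t D).
Qed.

Lemma al_norm_neq0 j : form (al j) (al j) != 0.
Proof.
have := al_norm j; apply: contra_eq_neq => ->; rewrite !mul0r eq_sym.
by rewrite pnatr_eq0 -lt0n comark_gt0.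
Qed.

Lemma cartanE j k : cartan A al j k = 2 / form (al j) (al j) * form (al j) (al k).
Proof. by rewrite mxE formZl. Qed.

Lemma cartan_sum j (v : 'I_n.+1 -> R) : \sum_k cartan A al j k * v k =
  2 / form (al j) (al j) * \sum_k form (al j) (al k) * v k.
Proof. by rewrite mulr_sumr; apply: eq_bigr => k _; rewrite cartanE mulrA. Qed.

(** The vector sum_k v_k al_k - v_0 delta has no al_0 component and is orthogonal to every simple
    root, hence isotropic, hence zero. *)
Lemma al_kernel (v : 'I_n.+1 -> R) : (forall j, \sum_k form (al j) (al k) * v k = 0) ->
  forall k, v k = v ord0 * (mark k)%:R.
Proof.
move=> v0; pose x := \sum_k v k *: al k - v ord0 *: delta.
have xE : x = \sum_i (v (lift ord0 i) - v ord0 * (e i * t i)%:R) *: b i.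
  rewrite /x -sum_mark !big_ord_recl mark0 scale1r scalerDr.
  rewrite opprD addrACA subrr add0r scaler_sumr -sumrB.
  by apply: eq_bigr => i _; rewrite markS alb scalerA scalerBl.
have fx : fin x by rewrite xE; apply: fin_sum => i _; apply/finZ/datum_fin.
have alx j : form (al j) x = 0.
  rewrite /x !formE al_delta mulr0 subr0 form_sumr -[RHS](v0 j).
  by apply: eq_bigr => k _; rewrite formZr mulrC.
have x0 : x = 0.
  apply: (fin_anisotropic AF fx); rewrite {1}xE form_suml big1 // => i _.
  by rewrite formZl -alb alx mulr0.
move=> k; case: (unliftP ord0 k) => [i ->|->]; last by rewrite mark0 mulr1.
rewrite markS; apply/eqP; rewrite -subr_eq0; apply/eqP.
apply: (datum_free (u := fun i => v (lift ord0 i) - v ord0 * (e i * t i)%:R)).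
by rewrite -xE.
Qed.

Lemma labels_cartan : labels (cartan A al) = mark.
Proof.
apply: labels_unique => [||v v0]; first exact: mark0.
  apply: is_labels_intro; [exact: mark0|exact: mark_gt0|move=> j].
  rewrite (cartan_sum j (fun k => (mark k)%:R)); apply/eqP.
  rewrite mulf_eq0; apply/orP; right.
  apply/eqP; rewrite -[RHS](al_delta j) -sum_mark form_sumr.
  by apply: eq_bigr => k _; rewrite formZr mulrC.
apply: al_kernel => j; have := v0 j.
rewrite cartan_sum => /eqP; rewrite mulf_eq0 mulf_eq0 invr_eq0 pnatr_eq0.
by rewrite (negPf (al_norm_neq0 j)) /= => /eqP.
Qed.

(** Rescaling entry k by 2 / (al_k, al_k) turns a null vector of the transpose into one of the Gram
    matrix. *)
Lemma labels_cartanT : labels (cartan A al)^T = comark.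
Proof.
have cE j k (v : 'I_n.+1 -> R) : (cartan A al)^T j k * v k =
    form (al j) (al k) * (2 / form (al k) (al k) * v k).
  by rewrite mxE cartanE (formC AF (al k)); ring.
apply: labels_unique => [||v v0]; first exact: comark0.
  apply: is_labels_intro; [exact: comark0|exact: comark_gt0|move=> j].
  rewrite -[RHS](al_delta j) -sum_mark form_sumr; apply: eq_bigr => k _.
  rewrite (cE j k (fun k => (comark k)%:R)) formZr -al_norm.
  by have kk := al_norm_neq0 k; field.
have ker := al_kernel (v := fun k => 2 / form (al k) (al k) * v k).
move=> k; have /ker /(_ k) : forall j, \sum_k form (al j) (al k) *
    (2 / form (al k) (al k) * v k) = 0.
  by move=> j; rewrite -[RHS](v0 j); apply: eq_bigr => l _; rewrite cE.
have -> : form (al ord0) (al ord0) = 2.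
  by have := al_norm ord0; rewrite mark0 comark0; lra.
rewrite -al_norm /= => vk; have kk := al_norm_neq0 k.
have -> : v ord0 * (form (al k) (al k) / 2 * (mark k)%:R) =
    form (al k) (al k) / 2 * (2 / 2 * v ord0 * (mark k)%:R) by field.
by rewrite -vk; field.
Qed.

Lemma dcoefE i : dcoef A al i = (e i)%:R / (f i)%:R.
Proof.
rewrite /dcoef /label_ratio labels_cartan labels_cartanT markS comarkS !natrM.
have fi := f_neq0 i; have : (t i)%:R != 0 :> R by rewrite pnatr_eq0 -lt0n (rd_t D).
by move=> ti; field; rewrite fi ti.
Qed.

(** As e_i or f_i is 1, the maximum of 1 and d_i = e_i / f_i is e_i. *)
Lemma ecoefE i : ecoef A al i = (e i)%:R.
Proof.
rewrite /ecoef dcoefE; have [->|->] := rd_ef D i.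
  rewrite max_l // mul1r invf_le1 ?ler1n ?ltr0n; exact: (rd_f D).
by rewrite divr1 max_r // ler1n (rd_e D).
Qed.

Lemma AvecE : Avec A al = Av.
Proof. by apply/funext => i; rewrite /Avec ecoefE /fin_simple alb. Qed.

Lemma datum_fin_Weyl : fin_Weyl A (fin_simple al) = fin_Weyl A Av.
Proof. by rewrite fin_simpleE -(fin_Weyl_scale _ b e_neq0). Qed.

Lemma datum_Weyl : Weyl A al = [set w | exists mu w',
  [/\ Mlattice A al mu, fin_Weyl A (fin_simple al) w' & w = lambda A mu \o w']].
Proof.
rewrite /Mlattice AvecE datum_fin_Weyl.
apply: (WeylE AF scaled_fin scaled_free scaled_gt0 scaled_diag scaled_le0 scaled_form
  scaled_t (rd_norm D) al0) => i.
by rewrite fin_simpleE reflectionZ ?e_neq0.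
Qed.

(** The factor e_i of A_i clears the denominator: (A_i, b_j) = f_i c_ij. *)
Lemma datum_int mu x : Mlattice A al mu -> fin_Qlattice al x -> form mu x \is a Num.int.
Proof.
rewrite /Mlattice /fin_Qlattice AvecE fin_simpleE => -[u ->] [v ->].
rewrite form_combl rpred_sum // => i _; rewrite rpredM ?intr_int //.
rewrite form_combr rpred_sum // => j _; rewrite rpredM ?intr_int //.
rewrite formZl (rd_form D) mulrA mulrCA divff ?e_neq0 // mulr1.
by rewrite rpredM ?intr_int ?natr_int.
Qed.

End Affine.
End Datum.
End RootDatum.

(** * The involution iota *)

Section Pairs.
Variables (R : realType) (n : nat) (A : 'M[int]_n.+1).
Hypothesis AF : affine_form R A.
Local Notation V := (hstar R n).
Local Notation form := (@Defs.form R n A).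
Local Notation reflection := (@reflection R n A).
Local Notation delta := (delta R A).
Implicit Types (b : 'I_n -> V) (e f t : 'I_n -> nat) (c : 'I_n -> 'I_n -> int).

Lemma image_int_span (a : R) (v : 'I_n -> V) :
  int_span (fun i => a *: v i) = [set a *: x | x in int_span v].
Proof.
have E (d : 'I_n -> int) :
    \sum_i (a *: v i) *~ d i = a *: \sum_i v i *~ d i.
  by rewrite scaler_sumr; apply: eq_bigr => i _; rewrite scalerMzr.
apply/seteqP; split=> [_ [d ->]|_ [_ [d ->] <-]]; last by exists d; rewrite E.
by rewrite E; exists (\sum_i v i *~ d i) => //; exists d.
Qed.

Lemma dual_systems_self b e f c t al :
  root_datum A b e f c t -> (forall i, e i = 1%N) ->
  al ord0 = delta - comb (scaled b e) (Posz \o t) ->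
  (forall i, al (lift ord0 i) = b i) ->
  [/\ dual_systems A 1 al al & iota_root A al = al].
Proof.
move=> D e1 al0 alb; have ec i : ecoef A al i = 1 by rewrite (ecoefE AF D al0 alb) e1.
have p1 : pnum A al = 1.
  (* Both a value found by [xget] and its default are 1. *)
  by rewrite /pnum; case: xgetP => // x _ [i _ ->]; apply: ec.
have AvE : Avec A al = fin_simple al.
  by apply/funext => i; rewrite /Avec ec scale1r.
have io : iota_root A al = al.
  apply/funext => j; rewrite /iota_root p1 eqxx /iota_fin p1 sqrtr1 invr1.
  by case: unliftP => [i ->|->] //; rewrite scale1r AvE.
split=> //; split=> //.
- by move=> i; rewrite /fin_simple alb; apply: (datum_fin D).
- rewrite /Mlattice /fin_Qlattice AvE sqrtr1 -[LHS]image_id.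
  by congr image; apply/funext => x; rewrite scale1r.
- exact: (datum_Weyl AF D al0 alb).
- exact: (datum_int AF D al0 alb).
Qed.

(** With f = 1 the norm of b_i is 2 / e_i, so the short simple roots are those with the largest
    e_i. *)
Lemma pnumE (p : nat) b e f c t al :
  root_datum A b e f c t -> (forall i, f i = 1%N) ->
  (forall i, e i <= p)%N -> (exists i, e i = p) ->
  al ord0 = delta - comb (scaled b e) (Posz \o t) ->
  (forall i, al (lift ord0 i) = b i) -> pnum A al = p%:R.
Proof.
move=> D f1 ep [i0 i0p] al0 alb.
have nE i : form (fin_simple al i) (fin_simple al i) = 2 / (e i)%:R.
  by rewrite /fin_simple alb (datum_norm D) f1 mulr1.
have e0 i : 0 < (e i)%:R :> R by rewrite ltr0n (rd_e D).
apply: xget_unique => [|x [i /(_ i0)]].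
  exists i0; last by rewrite (ecoefE AF D al0 alb) i0p.
  by move=> k; rewrite !nE ler_pM2l // lef_pV2 ?posrE // ler_nat i0p.
rewrite !nE ler_pM2l // lef_pV2 ?posrE // ler_nat i0p => pe ->.
by rewrite (ecoefE AF D al0 alb); congr (_%:R); apply/eqP; rewrite eqn_leq ep.
Qed.

(** * Two root data exchanged by iota *)

Section Pair.
Variables (p : nat) (b bi : 'I_n -> V) (e ei : 'I_n -> nat).
Variables (c ci : 'I_n -> 'I_n -> int) (t ti : 'I_n -> nat).
Local Notation one := (fun=> 1%N).
Local Notation s := (Num.sqrt p%:R : R).
Hypothesis p_gt1 : (1 < p)%N.
Hypothesis D : root_datum A b e one c t.
Hypothesis Di : root_datum A bi ei one ci ti.
Hypothesis ep : forall i, e i = 1%N \/ e i = p.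
Hypothesis eei : forall i, (e i * ei i = p)%N.
Hypothesis bE : forall i, scaled b e i = s *: bi i.
Hypothesis biE : forall i, scaled bi ei i = s *: b i.
Local Notation theta := (comb (scaled b e) (Posz \o t)).

Lemma p_gt0 : 0 < p%:R :> R.
Proof. by rewrite ltr0n (ltn_trans _ p_gt1). Qed.

Lemma sqrt_nat_neq0 : s != 0.
Proof. by rewrite gt_eqF // sqrtr_gt0 p_gt0. Qed.

Lemma sqrt_natK : s * s = p%:R.
Proof. by rewrite -expr2 sqr_sqrtr // ltW // p_gt0. Qed.

Lemma comb_scale v : comb (scaled bi ei) v = s *: comb b v.
Proof.
rewrite /comb scaler_sumr; apply: eq_bigr => i _.
by rewrite biE scalerMzr.
Qed.

Lemma datum_pair_Weyl : fin_Weyl A (scaled b e) = fin_Weyl A b.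
Proof. by rewrite fin_Weyl_scale // => i; apply: (e_neq0 D). Qed.

Lemma dual_pair_Weyl : fin_Weyl A bi = fin_Weyl A b.
Proof.
rewrite -datum_pair_Weyl -(fin_Weyl_scale A bi (fun=> sqrt_nat_neq0)).
by congr fin_Weyl; apply/funext => i; rewrite -bE.
Qed.

Lemma dual_pair_Weyl_scaled : fin_Weyl A (scaled bi ei) = fin_Weyl A b.
Proof.
rewrite -(fin_Weyl_scale A b (fun=> sqrt_nat_neq0)).
by congr fin_Weyl; apply/funext => i; rewrite -biE.
Qed.

(** Here k_i = e_i, so the simple vector reached from theta has e_i = 1 and is the root b_i: theta
    is a long root. *)
Lemma theta_orbit : exists w i, [/\ fin_Weyl A b w, e i = 1%N & theta = w (b i)].
Proof.
have [w [i [Ww tE /eqP]]] := norm2_orbit AF (scaled_fin D) (scaled_free D)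
  (scaled_gt0 D) (scaled_diag D) (scaled_le0 D) (scaled_form D)
  (fun i => ltW (scaled_t D i)) (rd_norm D).
rewrite muln1 => /eqP ei1; exists w, i; split=> //; first by rewrite -datum_pair_Weyl.
by rewrite tE /scaled ei1 scale1r.
Qed.

(** Multiplied by sqrt p, the root lattice becomes the even lattice of the dual datum. *)
Lemma min_norm_Q v : comb b v != 0 -> 2 / p%:R <= form (comb b v) (comb b v).
Proof.
move=> v0; have := even_min_norm AF (scaled_fin Di) (scaled_diag Di)
  (scaled_form Di) (x := v).
rewrite comb_scale scaler_eq0 negb_or sqrt_nat_neq0 v0 => /(_ isT).
by rewrite !formE mulrA sqrt_natK ler_pdivrMr ?p_gt0 // mulrC.
Qed.

(** [dominant_bound] requires the norm of the root not to exceed the least norm of the lattice. Long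
    roots, of norm 2, are therefore bounded in M, and short ones, of norm 2 / p, in the root
    lattice. *)
Lemma highest_rootE : highest_root A b = theta.
Proof.
have bf := datum_fin D; have iso := fin_Weyl_isometry AF bf.
have thE : theta = comb b (fun i => (e i)%:Z * (t i)%:Z).
  apply: eq_bigr => i _; rewrite -!scaler_int scalerA rmorphM /=.
  by congr (_ *: _); ring.
have natE (d : 'I_n -> int) : (forall i, 0 <= d i) ->
    exists d' : 'I_n -> nat, comb b d = \sum_i b i *+ d' i.
  move=> d0; exists (absz \o d); apply: eq_bigr => i _ /=.
  by rewrite -[in LHS](gez0_abs (d0 i)).
have ob i j : i != j -> form (b i) (b j) <= 0.
  move=> ij; rewrite (rd_form D); apply: mulr_ge0_le0; first by rewrite divr_ge0.
  by rewrite lerz0 (rd_le0 D).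
have th_highest : is_highest_root A b theta.
  split.
    by have [w [i [Ww _ ->]]] := theta_orbit; exists w, i.
  move=> _ [w [i [Ww ->]]].
  have normw : form (w (b i)) (w (b i)) = 2 / (e i)%:R.
    by rewrite (iso_form (iso _ Ww)) (datum_norm D) mulr1.
  have [ei1|eip] := ep i.
    have [d dE] : int_span (scaled b e) (w (b i)).
      apply: (int_span_stable AF (scaled_gt0 D) (scaled_diag D) (scaled_form D)).
        by rewrite datum_pair_Weyl.
      exists (fun j => if j == i then 1 else 0).
      have := comb_single (scaled b e) i 1; rewrite /comb => ->.
      by rewrite /scaled ei1 scale1r.
    rewrite thE dE -/(comb (scaled b e) d).
    have -> : comb (scaled b e) d = comb b (fun i => (e i)%:Z * d i).
      apply: eq_bigr => j _; rewrite -!scaler_int scalerA rmorphM /=.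
      by congr (_ *: _); ring.
    rewrite -combB; apply: natE => j; rewrite -mulrBr mulr_ge0 // subr_ge0.
    apply: (dominant_bound AF (scaled_fin D) (scaled_free D)
      (even_obtuse (scaled_le0 D) (scaled_form D)) (mu := 2)
      (c := d) (t := Posz \o t)).
    - exact: (even_min_norm AF (scaled_fin D) (scaled_diag D) (scaled_form D)).
    - exact: (scaled_t D).
    - by move=> l; rewrite formZr mulr_ge0 // (rd_dom D).
    - by rewrite /comb -dE normw ei1 divr1.
  have [d dE] : int_span b (w (b i)).
    (* Integrality of short roots is read off in the lattice of the dual datum, which is sqrt p
       times the root lattice. *)
    have : int_span (scaled bi ei) (w (s *: b i)).
      apply: (int_span_stable AF (scaled_gt0 Di) (scaled_diag Di) (scaled_form Di)).
        by rewrite dual_pair_Weyl_scaled.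
      exists (fun j => if j == i then 1 else 0).
      by have := comb_single (scaled bi ei) i 1; rewrite /comb => ->; rewrite biE.
    move=> [d]; rewrite -/(comb (scaled bi ei) d) comb_scale (isoZ (iso _ Ww)).
    by move=> /(scalerI sqrt_nat_neq0) ->; exists d.
  rewrite dE -/(comb b d) thE -combB; apply: natE => j; rewrite subr_ge0.
  apply: (dominant_bound AF bf (datum_free D) ob (mu := 2 / p%:R)
    (c := d) (t := fun i => (e i)%:Z * (t i)%:Z)).
  - exact: min_norm_Q.
  - by move=> l; have := rd_e D l; have := rd_t D l; nia.
  - by move=> l; rewrite -thE (rd_dom D).
  - by rewrite /comb -dE normw eip.
(* Of two highest roots each exceeds the other by a nonnegative combination; the two combinations
   add up to zero. *)
apply: xget_unique => // th [thr thm]; have [ththr ththm] := th_highest.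
have [d dE] := thm _ ththr; have [d' d'E] := ththm _ thr.
have /(comb_eq0 (datum_free D)) dd0 : comb b (fun i => (d i)%:Z - - (d' i)%:Z) = 0.
  rewrite combB; transitivity ((th - theta) + (theta - th)).
    rewrite dE d'E; congr (_ + _); rewrite /comb -sumrN; apply: eq_bigr => i _.
    by rewrite mulrNz opprK.
  by rewrite addrA subrK subrr.
apply/eqP; rewrite -subr_eq0 dE; apply/eqP; rewrite big1 // => i _.
have := dd0 i; rewrite opprK => /eqP; rewrite -PoszD eqz_nat addn_eq0.
move=> /andP[/eqP -> _].
by rewrite mulr0n.
Qed.

End Pair.
End Pairs.

Section Iota.
Variables (R : realType) (n : nat) (A : 'M[int]_n.+1).
Hypothesis AF : affine_form R A.
Local Notation V := (hstar R n).
Local Notation form := (@Defs.form R n A).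
Local Notation delta := (delta R A).
Local Notation one := (fun=> 1%N).

Lemma dual_systems_pair (p : nat) (b bi : 'I_n -> V) (e ei : 'I_n -> nat)
    (c ci : 'I_n -> 'I_n -> int) (t ti : 'I_n -> nat) (al ali : 'I_n.+1 -> V) :
  (1 < p)%N ->
  root_datum A b e one c t -> root_datum A bi ei one ci ti ->
  (forall i, e i = 1%N \/ e i = p) -> (forall i, (e i * ei i = p)%N) ->
  (forall i, scaled b e i = Num.sqrt p%:R *: bi i) ->
  (forall i, scaled bi ei i = Num.sqrt p%:R *: b i) ->
  al ord0 = delta - comb (scaled b e) (Posz \o t) ->
  (forall i, al (lift ord0 i) = b i) ->
  ali ord0 = delta - comb (scaled bi ei) (Posz \o ti) ->
  (forall i, ali (lift ord0 i) = bi i) ->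
  dual_systems A p%:R al ali.
Proof.
move=> p1 D Di ep eei bE biE al0 alb ali0 alib.
have p0 : (0 < p)%N by apply: ltn_trans p1.
have eip i : ei i = 1%N \/ ei i = p.
  by have := eei i; have [->|->] := ep i => ?; [right|left]; nia.
have s0 := sqrt_nat_neq0 R p1.
have pE : pnum A al = p%:R.
  apply: (pnumE AF D _ _ _ al0 alb) => // [i|].
    by have [->|->] := ep i.
  (* A simple root with e_i = p exists because the theta of the dual datum is conjugate to one with
     dual coefficient 1. *)
  have [w [i [_ ei1 _]]] := theta_orbit AF Di.
  by exists i; have := eei i; rewrite ei1 muln1.
have ifE : iota_fin A al = bi.
  apply/funext => i; rewrite /iota_fin pE (AvecE AF D al0 alb) bE scalerA.
  by rewrite mulVf // scale1r.
split.
- by rewrite ltr0n.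
- exact: pE.
- apply/funext => j; rewrite /iota_root ifE pE.
  case: unliftP => [i ->|->]; first by rewrite alib.
  rewrite (_ : (p%:R == 1 :> R) = false); last first.
    by rewrite (eqr_nat R p 1) gtn_eqF.
  by rewrite ali0 (highest_rootE AF p1 Di D eip bE).
- by move=> i; rewrite /fin_simple alb; apply: (datum_fin D).
- by rewrite (fin_simpleE alb) (fin_simpleE alib) (dual_pair_Weyl p1 D bE).
- rewrite /Mlattice (AvecE AF Di ali0 alib) /fin_Qlattice (fin_simpleE alb).
  by rewrite -image_int_span; congr int_span; apply/funext => i.
- exact: (datum_Weyl AF D al0 alb).
- exact: (datum_int AF D al0 alb).
Qed.

(** Here s gives the highest short root of R, and sqrt p times it is the theta of the dual datum;
    this is the origin of the norm 2 / p. *)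
Lemma iota_datum (p : nat) (b : 'I_n -> V) (e : 'I_n -> nat)
    (c : 'I_n -> 'I_n -> int) (t s : 'I_n -> nat) :
  (1 < p)%N -> root_datum A b e one c t -> (forall i, e i = 1%N \/ e i = p) ->
  (forall i, (0 < s i)%N) ->
  form (comb b (Posz \o s)) (comb b (Posz \o s)) = 2 / p%:R ->
  (forall i, 0 <= form (comb b (Posz \o s)) (b i)) ->
  root_datum A (fun i => (Num.sqrt p%:R)^-1 *: scaled b e i) (fun i => p %/ e i)%N
    one (fun i j => c j i) s.
Proof.
move=> p1 D ep s0 snorm sdom.
have p0 : (0 < p)%N by apply: ltn_trans p1.
have sp0 : 0 < Num.sqrt p%:R :> R by rewrite sqrtr_gt0 ltr0n.
have spK := sqrt_natK R p; have sp := sqrt_nat_neq0 R p1.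
have eei i : (e i * (p %/ e i) = p)%N.
  by have [->|->] := ep i; rewrite ?divn1 ?mul1n // divnn p0 muln1.
have eeiR i : (e i)%:R * (p %/ e i)%:R = p%:R :> R by rewrite -natrM eei.
have ei0 i : (0 < p %/ e i)%N.
  by rewrite lt0n; apply/eqP => ei0; have := eei i; rewrite ei0; lia.
have eiR i : (p %/ e i)%:R != 0 :> R by rewrite pnatr_eq0 -lt0n.
have e_table_neq0 i := e_neq0 D i.
(* Symmetry of the form: conjugating c by the e_i transposes it, hence the transposed Cartan matrix
   of the dual datum. *)
have cE i j : (e j)%:R * (c i j)%:~R = (e i)%:R * (c j i)%:~R :> R.
  have := formC AF (b i) (b j); rewrite !(rd_form D) !mul1r => cE.
  have ei0' := e_table_neq0 i; have ej0' := e_table_neq0 j.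
  transitivity ((e j)%:R * (e i)%:R * ((e i)%:R^-1 * (c i j)%:~R) : R).
    by field.
  by rewrite cE; field.
have cEz i j : (e j)%:Z * c i j = (e i)%:Z * c j i.
  by apply/eqP; rewrite -(eqr_int R) !rmorphM /= cE.
have combE : comb (scaled (fun i => (Num.sqrt p%:R)^-1 *: scaled b e i)
    (fun i => p %/ e i)%N) (Posz \o s) = Num.sqrt p%:R *: comb b (Posz \o s).
  rewrite /comb scaler_sumr; apply: eq_bigr => i _; rewrite -!scaler_int.
  rewrite /scaled !scalerA; congr (_ *: _).
  rewrite [LHS](_ : _ = ((e i)%:R * (p %/ e i)%:R) * (Num.sqrt p%:R)^-1 *
    ((Posz \o s) i)%:~R); last by ring.
  have -> : (e i)%:R * (p %/ e i)%:R = Num.sqrt p%:R * Num.sqrt p%:R :> R.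
    by rewrite spK eeiR.
  by rewrite mulfK.
split=> //.
- move=> i; have [r r0 bE] := rd_scale D i.
  exists ((Num.sqrt p%:R)^-1 * (e i)%:R * r);
    last by rewrite /scaled bE !scalerA ?mulrA.
  by rewrite !mulr_gt0 ?invr_gt0 // ltr0n (rd_e D).
- by move=> i; right.
- exact: (rd_diag D).
- by move=> i j ij; apply: (rd_le0 D); rewrite eq_sym.
- move=> i j; rewrite !formE (formC AF) (rd_form D).
  rewrite [LHS](_ : _ = (Num.sqrt p%:R * Num.sqrt p%:R)^-1 * (e i)%:R * (c j i)%:~R).
    by rewrite spK -(eeiR i); have ? := e_table_neq0 i; have ? := eiR i; field; apply/andP.
  by have ? := e_table_neq0 j; field; apply/andP.
(* By [cEz], (p / e_j) c_ji = (p / e_i) c_ij, which names the quotient. *)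
- move=> i j; apply/dvdzP; exists (c i j).
  apply: (@mulfI _ ((e i)%:Z * (e j)%:Z)).
    by have := rd_e D i; have := rd_e D j; nia.
  have := eei i; have := eei j; have := cEz i j.
  set x := (p %/ e i)%N; set y := (p %/ e j)%N; set u := c i j; set v := c j i.
  move=> uv yE xE; have {}yE : (e j)%:Z * y%:Z = p%:Z by rewrite -PoszM yE.
  have {}xE : (e i)%:Z * x%:Z = p%:Z by rewrite -PoszM xE.
  transitivity ((e i)%:Z * ((e j)%:Z * y%:Z) * v); first by ring.
  transitivity ((e j)%:Z * ((e i)%:Z * x%:Z) * u); last by ring.
  by rewrite yE xE mulrAC -uv; ring.
- rewrite combE !formE snorm mulrA spK mulrC divfK // pnatr_eq0; lia.
- move=> i; rewrite combE !formE; have := sdom i; have := ltW sp0 => s1 s2.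
  by rewrite !mulr_ge0 ?invr_ge0.
Qed.

(** The second conclusion contains, in [dual_iota], that iota is an involution. *)
Lemma dual_systems_iota (p : nat) (b : 'I_n -> V) (e : 'I_n -> nat)
    (c : 'I_n -> 'I_n -> int) (t s : 'I_n -> nat) (al : 'I_n.+1 -> V) :
  (1 < p)%N -> root_datum A b e one c t -> (forall i, e i = 1%N \/ e i = p) ->
  (forall i, (0 < s i)%N) ->
  form (comb b (Posz \o s)) (comb b (Posz \o s)) = 2 / p%:R ->
  (forall i, 0 <= form (comb b (Posz \o s)) (b i)) ->
  al ord0 = delta - comb (scaled b e) (Posz \o t) ->
  (forall i, al (lift ord0 i) = b i) ->
  dual_systems A p%:R al (iota_root A al) /\
  dual_systems A p%:R (iota_root A al) al.
Proof.
move=> p1 D ep s0 snorm sdom al0 alb.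
have p0 : (0 < p)%N by apply: ltn_trans p1.
have Di := iota_datum p1 D ep s0 snorm sdom.
set bi := fun i => _ in Di; set ei := fun i => _ in Di.
have sp := sqrt_nat_neq0 R p1.
have eei i : (e i * ei i = p)%N.
  by rewrite /ei; have [->|->] := ep i; rewrite ?divn1 ?mul1n // divnn p0 muln1.
have bE i : scaled b e i = Num.sqrt p%:R *: bi i.
  by rewrite /bi scalerA divff // scale1r.
have biE i : scaled bi ei i = Num.sqrt p%:R *: b i.
  rewrite /scaled /bi /scaled !scalerA mulrAC -natrM mulnC eei.
  by rewrite -[X in X / _](sqrt_natK R p) mulfK.
have eip i : ei i = 1%N \/ ei i = p.
  by have := eei i; have [->|->] := ep i => ?; [right|left]; nia.
(* Built from the datum; it is identified with [iota_root A al] by [dual_iota], where the highest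
   root enters. *)
pose ali j := if unlift ord0 j is Some i then bi i
  else delta - comb (scaled bi ei) (Posz \o s).
have ali0 : ali ord0 = delta - comb (scaled bi ei) (Posz \o s).
  by rewrite /ali unlift_none.
have alib i : ali (lift ord0 i) = bi i by rewrite /ali liftK.
have DD := dual_systems_pair p1 D Di ep eei bE biE al0 alb ali0 alib.
rewrite (dual_iota DD); split=> //.
apply: (dual_systems_pair p1 Di D eip _ biE bE ali0 alib al0 alb).
by move=> i; rewrite mulnC.
Qed.

(** Arbitrary [phi] and [phii] agree with [phi_map] on the groups, so bijectivity and inversion are
    inherited from [phi_mapK]. *)
Lemma dual_systems_phi (p : R) (al ali : 'I_n.+1 -> V) :
  dual_systems A p al ali -> dual_systems A p ali al ->
  let sqrtp := Num.sqrt (pnum A al) in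
  [/\ Mlattice A ali = [set sqrtp *: b | b in fin_Qlattice al],
      fin_Qlattice ali = [set sqrtp^-1 *: mu | mu in Mlattice A al],
      exists phi, is_phi A al phi,
      exists phii, is_phi A ali phii &
      forall phi phii, is_phi A al phi -> is_phi A ali phii ->
        [/\ set_bij (dWeyl A al) (dWeyl A ali) phi,
            forall g, dWeyl A al g -> phii (phi g) = g &
            forall g, dWeyl A ali g -> phi (phii g) = g]].
Proof.
move=> D Di; rewrite (dual_pnum D) /=; split.
- exact: (dual_M D).
- exact: (fin_Qlattice_dual D Di).
- by exists (phi_map A p); apply: (phi_map_is_phi AF D Di).
- by exists (phi_map A p); apply: (phi_map_is_phi AF Di D).
move=> phi phii Pphi Pphii.
have phiE := is_phi_unique AF D Pphi; have phiiE := is_phi_unique AF Di Pphii.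
have dphi := phi_set_fun AF D Di; have dphii := phi_set_fun AF Di D.
have K g : dWeyl A al g -> phii (phi g) = g.
  by move=> Wg; rewrite phiE // phiiE ?(phi_mapK AF D Di) //; apply: dphi.
have Ki g : dWeyl A ali g -> phi (phii g) = g.
  by move=> Wg; rewrite phiiE // phiE ?(phi_mapK AF Di D) //; apply: dphii.
split=> //; split.
- by move=> g Wg; rewrite phiE //; apply: dphi.
- move=> g h /set_mem Wg /set_mem Wh gh.
  by rewrite -(K g Wg) gh K.
- move=> g Wg; exists (phii g); last exact: Ki.
  by rewrite phiiE //; apply: dphii.
Qed.

End Iota.

(** * Labels of the affine diagrams *)

(** What the edge contributes to - sum_k a_jk v_k over k other than j. *)
Definition edge_sum (v : nat -> nat) (j : nat) (E : dynkin_edge) : nat :=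
  let: (j', k', x, y) := E in
  (if j == j' then x * v k' else if j == k' then y * v j' else 0)%N.

(** The last equation says that d_j^-1 a_jk is symmetric for d = e / f. *)
Definition edge_ok (N : nat) (e f : nat -> nat) (E : dynkin_edge) : bool :=
  let: (j, k, x, y) := E in
  [&& j != k, j <= N, k <= N & x * (f j * e k) == y * (f k * e j)]%N.

(** Edges are not loops, so their weights vanish on the diagonal and one formula covers all
    entries. *)
Lemma entryE X e f j k : all (edge_ok (affine_rank X) e f) (dynkin_edges X) ->
  affine_entry X j k =
  (2 * (j == k))%:Z - (\sum_(E <- dynkin_edges X) edge_weight j k E)%N%:Z.
Proof.
move=> /allP ok; rewrite /affine_entry.
case: eqP => [->|_]; last by rewrite muln0 add0r.
rewrite muln1 big_seq big1 ?subr0 // => -[[[j' k'] x] y] /ok /and4P[/negPf jk _ _ _] /=.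
case: (eqVneq k j') => [->|_] /=; first by rewrite jk.
by rewrite andbF.
Qed.

Lemma edge_weight_sum N e f (v : nat -> nat) j E : edge_ok N e f E ->
  (\sum_(k < N.+1) edge_weight j k E * v k)%N = edge_sum v j E.
Proof.
case: E => [[[j' k'] x] y] /and4P[/negPf jk j'N k'N _] /=.
have pick l z : (l <= N)%N ->
    (\sum_(k < N.+1) (if (k : nat) == l then z else 0) * v k = z * v l)%N.
  rewrite -ltnS => lN; rewrite (bigD1 (Ordinal lN)) //= eqxx big1 ?addn0 // => k kl.
  by rewrite -val_eqE /= in kl; rewrite (negPf kl).
case: (eqVneq j j') => [->|jj'] /=.
  rewrite -(pick k') //; apply: eq_bigr => k _; rewrite jk.
  by case: ((k : nat) == k').
case: (eqVneq j k') => [jk'|jk'] /=; last by rewrite big1.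
by rewrite -(pick j').
Qed.

Lemma entry_sum X e f (v : nat -> nat) (j : nat) :
  all (edge_ok (affine_rank X) e f) (dynkin_edges X) -> (j <= affine_rank X)%N ->
  \sum_(k < (affine_rank X).+1) affine_entry X j k * (v k)%:Z =
  (2 * v j)%:Z - (\sum_(E <- dynkin_edges X) edge_sum v j E)%N%:Z.
Proof.
move=> ok jN; transitivity (\sum_(k < (affine_rank X).+1)
   (((2 * (j == k)) * v k)%:Z -
    (\sum_(E <- dynkin_edges X) edge_weight j k E * v k)%N%:Z)).
  apply: eq_bigr => k _; rewrite (entryE _ _ ok) mulrBl PoszM; congr (_ - _).
  by rewrite -PoszM big_distrl.
rewrite sumrB; congr (_ - _).
  rewrite -ltnS in jN; rewrite (bigD1 (Ordinal jN)) //= eqxx muln1 big1 ?addr0 //.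
  move=> k kj; rewrite -val_eqE /= eq_sym in kj.
  by rewrite (negPf kj) muln0 mul0n.
rewrite -(big_morph Posz PoszD (erefl _)) exchange_big /=; congr Posz.
rewrite big_seq [RHS]big_seq; apply: eq_bigr => E EX.
by apply: (edge_weight_sum (e := e) (f := f)); exact: (allP ok).
Qed.

Lemma entry_sym X e f j k : all (edge_ok (affine_rank X) e f) (dynkin_edges X) ->
  affine_entry X j k * (f j * e k)%:Z = affine_entry X k j * (f k * e j)%:Z.
Proof.
move=> ok; rewrite !(entryE _ _ ok) !mulrBl -!PoszM; congr (_%:Z - _%:Z).
  by rewrite eq_sym; case: eqP => [->|_] //; rewrite !muln0 !mul0n.
rewrite !big_distrl /= big_seq [RHS]big_seq; apply: eq_bigr => E EX.
case: E EX => [[[j' k'] x] y] /(allP ok) /and4P[/negPf jk _ _ /eqP xy] /=.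
have [?|?] := eqVneq j j'; have [?|?] := eqVneq j k'; have [?|?] := eqVneq k j';
  have [?|?] := eqVneq k k'; subst; rewrite ?eqxx // in jk *; rewrite ?xy //=.
Qed.

(** It reduces the row equations of diagrams of arbitrary rank to conditionals that [lia] can
    decide. *)
Lemma chain_sum (v : nat -> nat) j l m : (l <= m)%N ->
  (\sum_(E <- simple_chain l m) edge_sum v j E =
   (if l <= j < m then v j.+1 else 0) + (if l < j <= m then v j.-1 else 0))%N.
Proof.
move=> lm; rewrite /simple_chain big_map.
rewrite -{2 3}(subnKC lm); move: (m - l)%N => d {lm}; elim: d l => [|d IHd] l.
  by rewrite big_nil addn0; do 2 (case: ifP => ?; first lia).
rewrite big_cons IHd /= !mul1n.
have [->|jl] := eqVneq j l.
  have [-> -> -> ->] : [/\ (l <= l < l + d.+1)%N = true, (l < l <= l + d.+1)%N = false,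
    (l < l < l.+1 + d)%N = false & (l.+1 < l <= l.+1 + d)%N = false] by split; lia.
  by rewrite !addn0.
have -> : (l <= j < l + d.+1)%N = (l < j < l.+1 + d)%N by lia.
have [->|jl1] := eqVneq j l.+1.
  have [-> ->] : (l.+1 < l.+1 <= l.+1 + d)%N = false /\
    (l < l.+1 <= l + d.+1)%N = true by split; lia.
  by rewrite /= addn0 addnC.
have -> : (l < j <= l + d.+1)%N = (l.+1 < j <= l.+1 + d)%N by lia.
by rewrite add0n.
Qed.

(* e_j / f_j = d_j, and e_j t_j, f_j t_j are the labels of the diagram and of the
   dual diagram. *)
Record label_table (X : affine_type) (e f t : nat -> nat) : Prop := LabelTable {
  lt_zero : [/\ e 0 = 1, f 0 = 1 & t 0 = 1]%N;
  lt_pos : forall j, (j <= affine_rank X)%N -> [&& 0 < e j, 0 < f j & 0 < t j]%N;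
  lt_edges : all (edge_ok (affine_rank X) e f) (dynkin_edges X);
  lt_null : forall j, (j <= affine_rank X)%N ->
    (2 * (e j * t j) =
     \sum_(E <- dynkin_edges X) edge_sum (fun k => e k * t k) j E)%N }.

(* s_1, ..., s_n are the coefficients of the highest short root, which pairs to
   1 with the simple coroot of index j0 and to 0 with the other ones. *)
Record short_table (X : affine_type) (e : nat -> nat) (p : nat)
    (s : nat -> nat) (j0 : nat) : Prop := ShortTable {
  st_p : (1 < p)%N;
  st_e : forall j, e j = 1%N \/ e j = p;
  st_zero : s 0%N = 0%N;
  st_pos : forall j, (0 < j <= affine_rank X)%N -> (0 < s j)%N;
  st_j0 : (0 < j0 <= affine_rank X)%N;
  st_norm : (p * s j0 = 2 * e j0)%N;
  st_row : forall j, (0 < j <= affine_rank X)%N ->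
    (2 * s j = (j == j0) + \sum_(E <- dynkin_edges X) edge_sum s j E)%N }.

(** The first alternative is met by the simply laced and the twisted types (p = 1), the second by B,
    C, F4 and G2 untwisted. *)
Definition has_tables (X : affine_type) : Prop :=
  exists e f t, label_table X e f t /\
    ((forall j, e j = 1%N) \/
     (forall j, f j = 1%N) /\ exists p s j0, short_table X e p s j0).

Lemma chain_all N e f l m : (m <= N)%N ->
  (forall i, l <= i < m -> f i * e i.+1 = f i.+1 * e i)%N ->
  all (edge_ok N e f) (simple_chain l m).
Proof.
move=> mN ef; apply/allP => E /mapP [i]; rewrite mem_iota => ilm -> /=.
have [lm|ml] := leqP l m; last by lia.
by rewrite ef; [apply/and4P; split; lia|lia].
Qed.

Local Notation one := (fun=> 1%N).

Ltac row_cases :=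
  rewrite /edge_sum /=; repeat (case: ifP => ? /=; try (exfalso; lia));
  rewrite //=; lia.

Lemma tables_A n : affine_type_valid (AffA n) -> has_tables (AffA n).
Proof.
move=> /= n1; exists one, one, one; split; last by left.
split=> //=; have [->|n_neq1] := eqVneq n 1%N; first by [].
- apply/andP; split; first by apply/and4P; split; lia.
  exact: chain_all.
- by move=> j jn; rewrite big_seq1; row_cases.
- by move=> j jn; rewrite big_cons chain_sum //; row_cases.
Qed.

Lemma tables_B n : affine_type_valid (AffB n) -> has_tables (AffB n).
Proof.
move=> /= n3.
(* Hiding the table behind an existential stops simplification from unfolding it. *)
have [e eE] : exists e : nat -> nat,
  forall j, e j = (if j == n then 2 else 1)%N by eexists.
have [t tE] : exists t : nat -> nat,
  forall j, t j = (if (j <= 1) || (j == n) then 1 else 2)%N by eexists.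
exists e, one, t; split.
  split=> /=.
  - by split=> //; rewrite !eE; case: ifP; lia.
  - by move=> j _; rewrite eE tE; do 2 case: ifP.
  - rewrite all_cat chain_all; [|exact: leq_pred|]; last first.
      by move=> i i1; rewrite !eE; do 2 (case: ifP => ? /=); lia.
    by rewrite /= !eE ?andbT; row_cases.
  - move=> j jn; rewrite big_cons big_cat big_seq1 /= chain_sum; last by lia.
    by rewrite /edge_sum /= !eE !tE; row_cases.
(* The highest short root of B_n is the sum of all simple roots. *)
right; split=> //; exists 2, (fun j => (0 < j : nat)), 1; split=> //=.
- by move=> j; rewrite !eE; case: ifP; auto.
- by move=> j /andP[->].
- by lia.
- by rewrite !eE; case: ifP; lia.
- move=> j jn; rewrite big_cons big_cat big_seq1 /= chain_sum; last by lia.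
  by row_cases.
Qed.

Lemma tables_C n : affine_type_valid (AffC n) -> has_tables (AffC n).
Proof.
move=> /= n2.
have [e eE] : exists e : nat -> nat,
  forall j, e j = (if (j == 0) || (j == n) then 1 else 2)%N by eexists.
exists e, one, one; split.
  split=> /=.
  - by [].
  - by move=> j _; rewrite !eE; case: ifP.
  - rewrite all_cat chain_all; [|exact: leq_pred|]; last first.
      by move=> i i1; rewrite !eE; do 2 (case: ifP => ? /=); lia.
    by rewrite /= !eE ?andbT; row_cases.
  - move=> j jn; rewrite big_cons big_cat big_seq1 /= chain_sum; last by lia.
    by rewrite /edge_sum /= !eE; row_cases.
right; split=> //.
(* The highest short root of C_n: coefficient 1 at both ends, 2 in between. *)
exists 2, (fun j => if j == 0 then 0 else if (j == 1) || (j == n) then 1 else 2)%N, 2.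
split=> //=.
- by move=> j; rewrite !eE; case: ifP; auto.
- by move=> j jn; row_cases.
- by rewrite !eE; case: ifP => ?; lia.
- move=> j jn; rewrite big_cons big_cat big_seq1 /= chain_sum; last by lia.
  by row_cases.
Qed.

Lemma tables_D n : affine_type_valid (AffD n) -> has_tables (AffD n).
Proof.
move=> /= n4.
have [t tE] : exists t : nat -> nat,
  forall j, t j = (if (j <= 1) || (n.-1 <= j) then 1 else 2)%N by eexists.
exists one, one, t; split; last by left.
split=> //=.
- by move=> j _; rewrite !tE; case: ifP.
- by rewrite all_cat chain_all //=; lia.
- move=> j jn; rewrite big_cons big_cat big_seq1 /= chain_sum; last by lia.
  by rewrite /edge_sum /= !tE; row_cases.
Qed.

Lemma tables_A2odd n : affine_type_valid (AffA2odd n) -> has_tables (AffA2odd n).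
Proof.
move=> /= n3.
have [f fE] : exists f : nat -> nat,
  forall j, f j = (if j == n then 2 else 1)%N by eexists.
have [t tE] : exists t : nat -> nat,
  forall j, t j = (if (j <= 1) || (j == n) then 1 else 2)%N by eexists.
exists one, f, t; split; last by left.
split=> /=.
- by split=> //; rewrite !fE; case: ifP; lia.
- by move=> j _; rewrite fE tE; do 2 case: ifP.
- rewrite all_cat chain_all; [|exact: leq_pred|]; last first.
    by move=> i i1; rewrite !fE; do 2 (case: ifP => ? /=); lia.
  by rewrite /= !fE ?andbT; row_cases.
- move=> j jn; rewrite big_cons big_cat big_seq1 /= chain_sum; last by lia.
  by rewrite /edge_sum /= !tE; row_cases.
Qed.

Lemma tables_D2 n : affine_type_valid (AffD2 n) -> has_tables (AffD2 n).
Proof.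
move=> /= n2.
have [f fE] : exists f : nat -> nat,
  forall j, f j = (if (j == 0) || (j == n) then 1 else 2)%N by eexists.
exists one, f, one; split; last by left.
split=> /=.
- by [].
- by move=> j _; rewrite !fE; case: ifP.
- rewrite all_cat chain_all; [|exact: leq_pred|]; last first.
    by move=> i i1; rewrite !fE; do 2 (case: ifP => ? /=); lia.
  by rewrite /= !fE ?andbT; row_cases.
- move=> j jn; rewrite big_cons big_cat big_seq1 /= chain_sum; last by lia.
  by row_cases.
Qed.

(** The default 1 lets [st_e] hold also at indices beyond the diagram. *)
Definition lookup (s : seq nat) (j : nat) : nat := nth 1%N s j.

Lemma tables_E6 : has_tables AffE6.
Proof.
exists one, one, (lookup [:: 1; 1; 2; 3; 2; 1; 2]); split; last by left.
split=> //.
  by do 7 (case=> [//|]).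
by do 7 (case=> [_|]; first by rewrite unlock).
Qed.

Lemma tables_E7 : has_tables AffE7.
Proof.
exists one, one, (lookup [:: 1; 2; 3; 4; 3; 2; 1; 2]); split; last by left.
split=> //.
  by do 8 (case=> [//|]).
by do 8 (case=> [_|]; first by rewrite unlock).
Qed.

Lemma tables_E8 : has_tables AffE8.
Proof.
exists one, one, (lookup [:: 1; 2; 3; 4; 5; 6; 4; 2; 3]); split; last by left.
split=> //.
  by do 9 (case=> [//|]).
by do 9 (case=> [_|]; first by rewrite unlock).
Qed.

Lemma tables_E6tw2 : has_tables AffE6tw2.
Proof.
exists one, (lookup [:: 1; 1; 1; 2; 2]), (lookup [:: 1; 2; 3; 2; 1]).
split; last by left.
split=> //.
  by do 5 (case=> [//|]).
by do 5 (case=> [_|]; first by rewrite unlock).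
Qed.

Lemma tables_D4tw3 : has_tables AffD4tw3.
Proof.
exists one, (lookup [:: 1; 1; 3]), (lookup [:: 1; 2; 1]); split; last by left.
split=> //.
  by do 3 (case=> [//|]).
by do 3 (case=> [_|]; first by rewrite unlock).
Qed.

Lemma tables_F4 : has_tables AffF4.
Proof.
exists (lookup [:: 1; 1; 1; 2; 2]), one, (lookup [:: 1; 2; 3; 2; 1]); split.
  split=> //.
    by do 5 (case=> [//|]).
  by do 5 (case=> [_|]; first by rewrite unlock).
right; split=> //; exists 2%N, (lookup [:: 0; 1; 2; 3; 2]), 4%N; split=> //.
- by do 5 (case=> [|]; first by auto); case; auto.
- by do 5 (case=> [//|]).
- by case=> [//|]; do 4 (case=> [_|]; first by rewrite unlock).
Qed.

Lemma tables_G2 : has_tables AffG2.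
Proof.
exists (lookup [:: 1; 1; 3]), one, (lookup [:: 1; 2; 1]); split.
  split=> //.
    by do 3 (case=> [//|]).
  by do 3 (case=> [_|]; first by rewrite unlock).
right; split=> //; exists 3%N, (lookup [:: 0; 1; 2]), 2%N; split=> //.
- by do 3 (case=> [|]; first by auto); case; auto.
- by do 3 (case=> [//|]).
- by case=> [//|]; do 2 (case=> [_|]; first by rewrite unlock).
Qed.

Lemma affine_tables X : affine_type_valid X -> (forall l, X <> AffA2even l) ->
  has_tables X.
Proof.
case: X => [n|n|n|n||||||l|l|l||] valid nA2.
- exact: tables_A.
- exact: tables_B.
- exact: tables_C.
- exact: tables_D.
- exact: tables_E6.
- exact: tables_E7.
- exact: tables_E8.
- exact: tables_F4.
- exact: tables_G2.
- by case: (nA2 l).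
- exact: tables_A2odd.
- exact: tables_D2.
- exact: tables_E6tw2.
- exact: tables_D4tw3.
Qed.

Lemma corank1_kernel (F : fieldType) m (M : 'M[F]_m.+1) (a v : 'I_m.+1 -> F) :
  \rank M = m -> a ord0 = 1 -> (forall j, \sum_k M j k * a k = 0) ->
  (forall j, \sum_k M j k * v k = 0) -> forall k, v k = v ord0 * a k.
Proof.
move=> rM a0 Ma Mv k.
have sub (u : 'I_m.+1 -> F) : (forall j, \sum_k M j k * u k = 0) ->
    (\row_k u k <= kermx M^T)%MS.
  move=> Mu; apply/sub_kermxP/rowP => j; rewrite !mxE -[RHS](Mu j).
  by apply: eq_bigr => l _; rewrite !mxE mulrC.
have rk : \rank (kermx M^T) = 1%N by rewrite mxrank_ker mxrank_tr rM subSnn.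
have ra : \rank (\row_k a k) = 1%N.
  apply/eqP; rewrite eqn_leq rank_leq_row lt0n mxrank_eq0.
  by apply/eqP => /rowP /(_ ord0); rewrite !mxE a0 => /eqP; rewrite oner_eq0.
have /sub_rVP [x xE] : (\row_k v k <= \row_k a k)%MS.
  apply: submx_trans (sub v Mv) _.
  by rewrite -(mxrank_leqif_sup (sub a Ma)) ra rk.
have vE l : v l = x * a l by have /rowP /(_ l) := xE; rewrite !mxE.
by rewrite (vE k) (vE ord0) a0 mulr1.
Qed.

(** * The form and the root datum given by a label table *)

Section Tables.
Variables (R : realType) (n : nat) (A : 'M[int]_n.+1).
Variables (e f t : 'I_n.+1 -> nat).
Hypothesis gcm : generalized_cartan A.
Hypothesis indec : indecomposable A.
Hypothesis rankA : \rank (map_mx (intr : int -> R) A) = n.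
Hypothesis zero1 : [/\ e ord0 = 1, f ord0 = 1 & t ord0 = 1]%N.
Hypothesis pos : forall j, [&& 0 < e j, 0 < f j & 0 < t j]%N.
Hypothesis sym : forall j k, A j k * (f j * e k)%:Z = A k j * (f k * e j)%:Z.
Hypothesis null : forall j, \sum_k A j k * (e k * t k)%:Z = 0.
Local Notation V := (hstar R n).
Local Notation form := (@Defs.form R n A).
Local Notation AR := (map_mx (intr : int -> R) A).

Lemma e_table_neq0 j : (e j)%:R != 0 :> R.
Proof. by have /and3P[? _ _] := pos j; rewrite pnatr_eq0 -lt0n. Qed.
Lemma f_table_neq0 j : (f j)%:R != 0 :> R.
Proof. by have /and3P[_ ? _] := pos j; rewrite pnatr_eq0 -lt0n. Qed.
Lemma t_table_neq0 j : (t j)%:R != 0 :> R.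
Proof. by have /and3P[_ _ ?] := pos j; rewrite pnatr_eq0 -lt0n. Qed.

Lemma symR j k : (A j k)%:~R * (f j)%:R * (e k)%:R =
  (A k j)%:~R * (f k)%:R * (e j)%:R :> R.
Proof.
have := congr1 (intr : int -> R) (sym j k).
by rewrite !PoszM !rmorphM /= !mulrA.
Qed.

Lemma nullR j : \sum_k (A j k)%:~R * (e k * t k)%:R = 0 :> R.
Proof.
transitivity ((\sum_k A j k * (e k * t k)%:Z)%:~R : R); last by rewrite null.
by rewrite rmorph_sum /=; apply: eq_bigr => k _; rewrite intrM.
Qed.

Lemma labels_table : labels AR = (fun k => e k * t k)%N.
Proof.
have [e0 f0 t0] := zero1.
have nullAR j : \sum_k AR j k * (e k * t k)%:R = 0.
  by rewrite -[RHS](nullR j); apply: eq_bigr => k _; rewrite mxE.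
apply: labels_unique => [||v v0]; first by rewrite e0 t0.
  apply: is_labels_intro => [|k|//]; first by rewrite e0 t0.
  by have /and3P[? _ ?] := pos k; rewrite muln_gt0; apply/andP.
by apply: (corank1_kernel rankA) => //; rewrite e0 t0.
Qed.

(** Symmetry of d_j^-1 a_jk carries the null vector e t of the matrix to the null vector f t of its
    transpose. *)
Lemma labels_tableT : labels AR^T = (fun k => f k * t k)%N.
Proof.
have [e0 f0 t0] := zero1.
have nullAR j : \sum_k AR^T j k * (f k * t k)%:R = 0.
  apply: (mulfI (e_table_neq0 j)); rewrite mulr0 mulr_sumr.
  transitivity ((f j)%:R * \sum_k (A j k)%:~R * (e k * t k)%:R : R); last first.
    by rewrite nullR mulr0.
  rewrite mulr_sumr; apply: eq_bigr => k _.
  rewrite !mxE !natrM; transitivity ((A k j)%:~R * (f k)%:R * (e j)%:R * (t k)%:R : R).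
    by ring.
  by rewrite -symR; ring.
apply: labels_unique => [||v v0]; first by rewrite f0 t0.
  apply: is_labels_intro => [|k|//]; first by rewrite f0 t0.
  by have /and3P[_ ? ?] := pos k; rewrite muln_gt0; apply/andP.
apply: (corank1_kernel (M := AR^T)) => //; first by rewrite mxrank_tr.
by rewrite f0 t0.
Qed.

Lemma label_ratio_table j : label_ratio AR j = (e j)%:R / (f j)%:R.
Proof.
rewrite /label_ratio labels_table labels_tableT !natrM.
by have ? := f_table_neq0 j; have ? := t_table_neq0 j; field; apply/andP.
Qed.

Lemma form_alphaE j k :
  form (alpha R j) (alpha R k) = (f j)%:R / (e j)%:R * (A j k)%:~R.
Proof. by rewrite form_alpha label_ratio_table invf_div. Qed.

Lemma form_alphaC j k : form (alpha R j) (alpha R k) = form (alpha R k) (alpha R j).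
Proof.
rewrite !form_alphaE; have ej := e_table_neq0 j; have ek := e_table_neq0 k.
apply: (mulfI (mulf_neq0 ej ek)).
transitivity ((A j k)%:~R * (f j)%:R * (e k)%:R : R); first by field.
by rewrite symR; field.
Qed.

Lemma formC_table x y : form x y = form y x.
Proof.
have gramT : (gram R A)^T = gram R A.
  rewrite /gram tr_block_mx trmx0; congr block_mx.
  - apply/matrixP => j k; rewrite !mxE -!/(_ * _).
    by have := form_alphaC k j; rewrite !form_alpha.
  - by apply/matrixP => j k; rewrite !mxE.
  - by apply/matrixP => j k; rewrite !mxE.
rewrite /Defs.form; transitivity ((x *m gram R A *m y^T)^T 0 0).
  by rewrite [RHS]mxE.
by rewrite !trmx_mul trmxK gramT mulmxA.
Qed.

(* With y_j = x_j / a_j and G_jk = a_j a_k (alpha_j, alpha_k), whose rows sum to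
   zero, (x, x) = - 1/2 sum_jk G_jk (y_j - y_k)^2. *)
Lemma fin_anisotropic_table x : fin x -> form x x <= 0 -> x = 0.
Proof.
move=> fx xx; have [diag off _] := gcm.
pose a j := (e j * t j)%:R : R.
have a0 j : a j != 0 by rewrite /a natrM mulf_neq0 ?e_table_neq0 ?t_table_neq0.
pose y j := x 0 (lshift 1 j) / a j.
have xE : x = \sum_j (y j * a j) *: alpha R j.
  rewrite [LHS]row_sum_delta big_split_ord /= big_ord1 fx.2 scale0r addr0.
  by apply: eq_bigr => j _; rewrite /y divfK.
pose G j k := a j * a k * form (alpha R j) (alpha R k).
have GC j k : G j k = G k j by rewrite /G form_alphaC; ring.
have G0 j : \sum_k G j k = 0.
  rewrite /G; under eq_bigr => k _ do rewrite form_alphaE.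
  transitivity (a j * ((f j)%:R / (e j)%:R) * \sum_k (A j k)%:~R * (e k * t k)%:R).
    by rewrite mulr_sumr; apply: eq_bigr => k _; rewrite /a; ring.
  by rewrite nullR mulr0.
have Goff j k : j != k -> G j k <= 0.
  move=> jk; rewrite /G form_alphaE mulr_ge0_le0 ?mulr_ge0 //.
  rewrite mulr_ge0_le0 ?divr_ge0 // lerz0; exact: off.
have xxE : form x x = \sum_j \sum_k G j k * (y j * y k).
  rewrite {1}xE form_suml; apply: eq_bigr => j _.
  rewrite xE form_sumr; apply: eq_bigr => k _; rewrite !formE /G; ring.
have sqE : \sum_j \sum_k - G j k * (y j - y k) ^+ 2 = 2 * form x x.
  have S1 : \sum_j \sum_k G j k * y j ^+ 2 = 0.
    by rewrite big1 // => j _; rewrite -mulr_suml G0 mul0r.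
  have S2 : \sum_j \sum_k G j k * y k ^+ 2 = 0.
    rewrite exchange_big big1 // => k _ /=; rewrite -mulr_suml.
    by under eq_bigr => j _ do rewrite GC; rewrite G0 mul0r.
  rewrite xxE; apply/eqP; rewrite -subr_eq0 -(addr0 (_ - _)) -[X in _ + X]S1.
  rewrite -(addr0 (_ + _)) -[X in _ + X]S2 mulr_sumr -sumrB -!big_split /=.
  apply/eqP/big1 => j _; rewrite mulr_sumr -sumrB -!big_split /= big1 // => k _.
  by ring.
have term_ge0 j k : 0 <= - G j k * (y j - y k) ^+ 2.
  have [->|jk] := eqVneq j k; first by rewrite subrr expr0n mulr0.
  by rewrite mulr_ge0 ?sqr_ge0 // oppr_ge0 Goff.
have term0 j k : - G j k * (y j - y k) ^+ 2 = 0.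
  have S0 : \sum_j \sum_k - G j k * (y j - y k) ^+ 2 = 0.
    apply/eqP; rewrite eq_le; apply/andP; split; last by do 2 apply: sumr_ge0 => ? _.
    by rewrite sqE pmulr_rle0.
  have := psumr_eq0P (fun j _ => sumr_ge0 _ (fun k _ => term_ge0 j k)) S0 (i := j) isT.
  by move=> /psumr_eq0P /(_ k) -> //.
have y0 : y ord0 = 0 by rewrite /y fx.1 mul0r.
(* The squares force y to be constant along edges, so y_0 = 0 spreads by indecomposability. *)
pose S := [set j | y j == 0]%SET.
have ST : S = [set: 'I_n.+1]%SET.
  apply/eqP; apply: contraT => nST.
  have S0 : S != finset.set0.
    by apply/eqP => /setP /(_ ord0); rewrite !inE y0 eqxx.
  have [j [k [jS kS Ajk]]] := indec S0 nST.
  move: jS kS; rewrite !inE => /eqP yj yk.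
  have := term0 j k; rewrite yj sub0r sqrrN => /eqP.
  rewrite mulf_eq0 expf_eq0 /= (negPf yk) orbF oppr_eq0 /G form_alphaE.
  rewrite !mulf_eq0 invr_eq0 intr_eq0 (negPf Ajk) (negPf (a0 j)) (negPf (a0 k)).
  by rewrite (negPf (f_table_neq0 j)) (negPf (e_table_neq0 j)).
rewrite xE big1 // => j _.
by have : j \in S by [rewrite ST inE]; rewrite inE => /eqP ->; rewrite mul0r scale0r.
Qed.

Lemma affine_form_table : affine_form R A.
Proof.
have [e0 f0 t0] := zero1.
split.
- exact: formC_table.
- move=> j; rewrite /delta labels_table form_sumr.
  transitivity ((f j)%:R / (e j)%:R * \sum_k (A j k)%:~R * (e k * t k)%:R : R).
    rewrite mulr_sumr.
    by apply: eq_bigr => k _; rewrite -scaler_nat formZr form_alphaE; ring.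
  by rewrite nullR mulr0.
- by rewrite labels_table e0 t0.
- exact: fin_anisotropic_table.
Qed.

Local Notation b := (fun i : 'I_n => alpha R (lift ord0 i)).

Lemma alpha0_table :
  alpha R ord0 = delta R A - comb (scaled b (fun i => e (lift ord0 i)))
    (Posz \o (fun i => t (lift ord0 i))).
Proof.
have [e0 f0 t0] := zero1.
rewrite /delta labels_table big_ord_recl e0 t0 mulr1n.
apply/eqP; rewrite eq_sym subr_eq; apply/eqP; congr (_ + _).
apply: eq_bigr => i _; rewrite /scaled /= -scaler_nat natrM mulrC -scalerA.
by rewrite scaler_nat.
Qed.

(** Since delta is orthogonal to all roots, theta = delta - alpha_0 has the norm of alpha_0, and
    (theta, alpha_i) = - (alpha_0, alpha_i) is nonnegative. *)
Lemma datum_table :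
  (forall j, e j = 1%N \/ f j = 1%N) ->
  (forall i j : 'I_n, ((e (lift ord0 i))%:Z %|
    (e (lift ord0 j))%:Z * A (lift ord0 i) (lift ord0 j))%Z) ->
  root_datum A b (fun i => e (lift ord0 i)) (fun i => f (lift ord0 i))
    (fun i j => A (lift ord0 i) (lift ord0 j)) (fun i => t (lift ord0 i)).
Proof.
move=> ef dvd; have [e0 f0 t0] := zero1; have [diag off _] := gcm.
have AF := affine_form_table.
have thE : comb (scaled b (fun i => e (lift ord0 i)))
    (Posz \o (fun i => t (lift ord0 i))) = delta R A - alpha R ord0.
  by rewrite [X in _ = _ - X]alpha0_table opprB addrC subrK.
split=> //.
- by move=> i; exists 1 => //; rewrite scale1r.
- by move=> i; have /and3P[] := pos (lift ord0 i).
- by move=> i; have /and3P[] := pos (lift ord0 i).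
- by move=> i j ij; apply: off; rewrite (inj_eq lift_inj).
- by move=> i j; apply: form_alphaE.
- by move=> i; have /and3P[] := pos (lift ord0 i).
- rewrite thE !formE (form_delta_delta AF) (formC AF (delta R A)).
  rewrite (form_alpha_delta AF) form_alphaE e0 f0 diag; lra.
- move=> i; rewrite thE !formE (formC AF) (form_alpha_delta AF) sub0r oppr_ge0.
  rewrite form_alphaE mulr_ge0_le0 ?divr_ge0 // lerz0.
  exact: off.
Qed.

(** As s_0 = 0, a row of the affine matrix computes the pairing with a combination of finite simple
    roots. *)
Lemma form_short_table (s : nat -> nat) (j0 : nat) i : s 0%N = 0%N ->
  \sum_(k < n.+1) A (lift ord0 i) k * (s k)%:Z = (lift ord0 i == j0 :> nat)%:Z ->
  form (b i) (comb b (Posz \o (fun i => s (lift ord0 i)))) =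
  (f (lift ord0 i))%:R / (e (lift ord0 i))%:R * (lift ord0 i == j0 :> nat)%:R.
Proof.
move=> s0 row; rewrite form_combr.
transitivity ((f (lift ord0 i))%:R / (e (lift ord0 i))%:R *
  (\sum_(k < n.+1) A (lift ord0 i) k * (s k)%:Z)%:~R : R); last by rewrite row.
rewrite big_ord_recl [s ord0]s0 mulr0 add0r rmorph_sum /= mulr_sumr.
by apply: eq_bigr => k _; rewrite form_alphaE intrM /=; ring.
Qed.

End Tables.

Unset Implicit Arguments.

Theorem proposition2p1 (R : realType) (n : nat) (A : 'M[int]_n.+1)
    (affineA : affine_cartan R A)
    (enumA : exists X : affine_type, has_affine_type A X)
    (notA2even : forall l : nat, ~ has_affine_type A (AffA2even l)) :
  let al := @alpha R n in
  let ali := iota_root A al in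
  let sqrtp := Num.sqrt (pnum A al) in
  [/\ Mlattice A ali = [set sqrtp *: b | b in fin_Qlattice al],
      fin_Qlattice ali = [set sqrtp^-1 *: mu | mu in Mlattice A al],
      exists phi, is_phi A al phi,
      exists phii, is_phi A ali phii &
      forall phi phii, is_phi A al phi -> is_phi A ali phii ->
        [/\ set_bij (dWeyl A al) (dWeyl A ali) phi,
            forall g, dWeyl A al g -> phii (phi g) = g &
            forall g, dWeyl A ali g -> phi (phii g) = g]].
Proof.
have [X [valid rk AE]] := enumA.
have nA2 l : X <> AffA2even l.
  by move=> XE; apply: (notA2even l); rewrite -XE; split.
have [e [f [t [[[e0 f0 t0] pos ok null] alt]]]] := affine_tables valid nA2.
have [gcm indec rankA _ _] := affineA.
subst n.
pose e' (j : 'I_(affine_rank X).+1) := e j; pose f' (j : 'I_(affine_rank X).+1) := f j.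
pose t' (j : 'I_(affine_rank X).+1) := t j.
have z1 : [/\ e' ord0 = 1, f' ord0 = 1 & t' ord0 = 1]%N by [].
have pos' j : [&& 0 < e' j, 0 < f' j & 0 < t' j]%N by apply: pos; rewrite -ltnS ltn_ord.
have sym' j k : A j k * (f' j * e' k)%:Z = A k j * (f' k * e' j)%:Z.
  by rewrite !AE; apply: entry_sym ok.
have sumE (v : nat -> nat) (j : 'I_(affine_rank X).+1) : \sum_k A j k * (v k)%:Z =
    (2 * v j)%:Z - (\sum_(E <- dynkin_edges X) edge_sum v j E)%N%:Z.
  have jX : (j <= affine_rank X)%N by rewrite -ltnS ltn_ord.
  by rewrite -(entry_sum v ok jX); apply: eq_bigr => k _; rewrite AE.
have null' j : \sum_k A j k * (e' k * t' k)%:Z = 0.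
  by rewrite (sumE (fun k => e k * t k)%N) -null ?subrr // -ltnS ltn_ord.
have AF := affine_form_table gcm indec rankA z1 pos' sym' null'.
have al0 := alpha0_table rankA z1 pos' null'.
have datum := datum_table gcm indec rankA z1 pos' sym' null'.
case: alt => [e1|[f1 [p [s [j0 [p1 ep s0 spos j0n snorm row]]]]]].
  have dvd (i j : 'I_(affine_rank X)) : ((e' (lift ord0 i))%:Z %|
      (e' (lift ord0 j))%:Z * A (lift ord0 i) (lift ord0 j))%Z.
    apply/dvdzP; exists (A (lift ord0 i) (lift ord0 j)).
    by rewrite /e' !e1 mul1r mulr1.
  have D := datum (fun j => or_introl (e1 j)) dvd.
  have [|DS io] := dual_systems_self AF D _ al0 (fun=> erefl).
    by move=> i; apply: e1.
  by rewrite /= io; apply: (dual_systems_phi AF DS DS).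
have dvd (i j : 'I_(affine_rank X)) : ((e' (lift ord0 i))%:Z %|
    (e' (lift ord0 j))%:Z * A (lift ord0 i) (lift ord0 j))%Z.
  (* With f = 1, symmetry reads e_j a_ij = e_i a_ji, so e_i divides. *)
  have := sym' (lift ord0 i) (lift ord0 j); rewrite /f' !f1 !mul1n => AC.
  by apply/dvdzP; exists (A (lift ord0 j) (lift ord0 i)); rewrite mulrC.
have D := datum (fun j => or_intror (f1 j)) dvd.
have f1E : (fun i => f' (lift ord0 i)) = (fun=> 1%N) :> ('I_(affine_rank X) -> nat).
  by apply/funext => i; apply: f1.
rewrite f1E in D.
pose th := comb (fun i => alpha R (lift ord0 i))
  (Posz \o (fun i : 'I_(affine_rank X) => s (lift ord0 i))).
have lift_bd (i : 'I_(affine_rank X)) : (0 < lift ord0 i <= affine_rank X)%N.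
  by rewrite lift0 ltn_ord.
have thE i : Defs.form A (alpha R (lift ord0 i)) th =
    (e (lift ord0 i))%:R^-1 * (lift ord0 i == j0 :> nat)%:R.
  rewrite (form_short_table rankA z1 pos' sym' null' (j0 := j0) s0) /f' ?f1 ?mul1r //.
  by rewrite sumE row // PoszD addrK.
have [|||DS DSi] := dual_systems_iota AF p1 D (fun i => ep _)
    (s := fun i => s (lift ord0 i)) _ _ _ al0 (fun=> erefl).
- by move=> i; apply: spos.
(* Only the coroot j0 pairs nontrivially with the short root, so its norm is s_{j0} / e_{j0} = 2 /
   p. Vertex j0 + 1 is finite index j0 after the case split. *)
- case: j0 j0n thE snorm {row} => // j0 j0n thE snorm.
  rewrite form_combl (bigD1 (Ordinal j0n)) //= big1 => [|i ij].
    rewrite thE /= /bump /= eqxx mulr1 addr0.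
    have e_neq0 : (e j0.+1)%:R != 0 :> R.
      by have /and3P[? _ _] := pos j0.+1 j0n; rewrite pnatr_eq0 -lt0n.
    have p_neq0 : p%:R != 0 :> R by rewrite pnatr_eq0; lia.
    apply: (mulfI p_neq0); rewrite [RHS]mulrCA mulfV // mulr1 mulrA.
    have -> : p%:R * ((s j0.+1)%:Z)%:~R = 2 * (e j0.+1)%:R :> R.
      by rewrite -[2]/(2%:R) -!natrM -snorm.
    by rewrite mulfK.
  rewrite thE (_ : (_ == _) = false) ?mulr0 //.
  by rewrite lift0 eqSS; apply: contraNF ij => /eqP ij; apply/eqP/val_inj.
- by move=> i; rewrite (formC AF) thE mulr_ge0 ?invr_ge0.
exact: (dual_systems_phi AF DS DSi).
Qed.
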